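(* The function $G$ extends to a meromorphic function on $\mathbb C$. Its poles are exactly the points $t=2ki-\frac{i}{2}$ for $k\in\mathbb N=\{1,2,\dots\}$ and $t=-2\pi n^2$ for $n\in\mathbb N$, and all of them are simple.
   Context: $G$ is defined by the series $G(t)=\sum_{n=1}^\infty n^{-\frac12-it}\,\frac{t}{2\pi n^2+t}$, which converges absolutely and defines a meromorphic function on $\{t\in\mathbb C:\Im t<\frac32\}$. *)

(* Defs.v *)
From Stdlib Require Import Reals.
From Coquelicot Require Import Coquelicot.
Open Scope R_scope.

Definition Cexp (z : C) : C :=
  (exp (Re z) * cos (Im z), exp (Re z) * sin (Im z)).

Definition Cnpow (n : nat) (s : C) : C := Cexp (Cmult s (RtoC (ln (INR n)))).

(* The n-th term (n >= 1) of G(t) = sum_n n^{-1/2 - i t} * t / (2 pi n^2 + t). *)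
Definition G_term (t : C) (n : nat) : C :=
  Cmult (Cnpow n (Cminus (RtoC (-(1/2))) (Cmult Ci t)))
        (Cdiv t (Cplus (RtoC (2 * PI * (INR n) ^ 2)) t)).

Definition C_holo_at (F : C -> C) (z : C) : Prop :=
  @ex_derive C_AbsRing C_NormedModule F z.

Definition G_pole (z : C) : Prop :=
  (exists k : nat, (1 <= k)%nat /\ z = (0, 2 * INR k - 1/2)) \/
  (exists n : nat, (1 <= n)%nat /\ z = (- (2 * PI * (INR n) ^ 2), 0)).

Definition simple_pole (F : C -> C) (p : C) : Prop :=
  exists c : C, c <> RtoC 0 /\
  exists r : R, 0 < r /\
  exists h : C -> C,
    (forall z, Cmod (Cminus z p) < r -> C_holo_at h z) /\
    (forall z, Cmod (Cminus z p) < r -> z <> p ->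
       F z = Cplus (Cdiv c (Cminus z p)) (h z)).

(* Main.v *)
Require Import Defs.
From Stdlib Require Import Reals Lra Lia ClassicalEpsilon.
From Coquelicot Require Import Coquelicot.
Open Scope R_scope.

(** With u = t/(2 pi n^2), the n-th term of G is n^(-1/2-it) u/(1+u).  Splitting off
    the first K terms of u/(1+u) = u - u^2 + ... gives, for Im t < 3/2,
      G(t) = sum_(1<=j<=K) (-1)^(j-1) (t/2pi)^j zeta(1/2+it+2j) + R_K(t),
    where the series R_K converges for Im t < 3/2 + 2K and has only the poles -2 pi n^2,
    while the j-th zeta value has its pole at t = 2ji - i/2.  The right-hand sides for
    different K agree wherever their remainders converge, so no identity theorem is needed.

    zeta(s) - 1/(s-1) is continued to C in the same spirit: sum (n+1)^(1-s) - n^(1-s) = -1,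
    expanded by the binomial theorem in powers of 1/n, expresses zeta(s) through
    zeta(s+1), ..., zeta(s+m) and a series converging for Re s > -m.

    Sums of series are shown to be holomorphic without Cauchy's theorem: it suffices that
    the difference quotients of the terms at the point are dominated by a summable sequence. *)

(** Each estimate must control a term and its difference quotient at the centre at once, with a
    constant whose dependence on the index is explicit. [lip_at] pairs the two bounds because the
    pair survives products and integration in a real parameter: dominating sequences are then
    multiplied factor by factor, and no complex derivative is ever estimated. The binomial expansion
    is divided by e = 1 - s from the start. Telescoping yields (1 - s) times the wanted identity,
    and only the divided remainders stay meaningful at s = 1, where 1/(s-1) has to split off
    exactly. The two families of poles never meet: the points 2ki - i/2 have imaginary part at least
    3/2, the points -2 pi n^2 have imaginary part 0. Each kind can be studied in a disc free of the
    other, where the principal part is explicit and its coefficient visibly nonzero. *)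

(** * Continuity and complex differentiability at a point *)

Definition contC (f : C -> C) (z : C) : Prop :=
  forall eps, 0 < eps -> exists d, 0 < d /\
    forall w, Cmod (w - z) < d -> Cmod (f w - f z) < eps.

(* Caratheodory's form of differentiability. *)
Definition holo (f : C -> C) (z : C) : Prop :=
  exists (r : R) (phi : C -> C), 0 < r /\ contC phi z /\
    forall w, Cmod (w - z) < r -> f w = (f z + phi w * (w - z))%C.

Lemma Cmod_self (z : C) : Cmod (z - z) = 0.
Proof. replace (z - z)%C with (RtoC 0) by ring. apply Cmod_0. Qed.

Lemma Cmod_minus_sym (a b : C) : Cmod (a - b) = Cmod (b - a).
Proof. rewrite <- Cmod_opp. f_equal. ring. Qed.

Lemma Cmod_minus_ge (a b : C) : Cmod a - Cmod b <= Cmod (a - b).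
Proof.
  assert (H := Cmod_triangle (a - b) b).
  replace (a - b + b)%C with a in H by ring. lra.
Qed.

Lemma Cmod_minus_le (a b : C) : Cmod (a - b) <= Cmod a + Cmod b.
Proof. unfold Cminus. rewrite <- (Cmod_opp b). apply Cmod_triangle. Qed.

Lemma Im_le_Cmod (z : C) : Rabs (Im z) <= Cmod z.
Proof. eapply Rle_trans; [apply Rmax_r | apply (Rmax_Cmod z)]. Qed.

Lemma Cmod_le_Re_Im (z : C) : Cmod z <= Rabs (Re z) + Rabs (Im z).
Proof.
  replace z with (RtoC (Re z) + Ci * RtoC (Im z))%C at 1.
  - eapply Rle_trans; [apply Cmod_triangle|].
    rewrite Cmod_mult, Cmod_Ci, !Cmod_R. lra.
  - destruct z as [x y]. unfold Re, Im, Cplus, Cmult, Ci, RtoC; simpl.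
    f_equal; ring.
Qed.

Lemma Cminus_neq_0 (a b : C) : a <> b -> (a - b)%C <> 0.
Proof.
  intros H E. apply H. replace a with (a - b + b)%C by ring. rewrite E. ring.
Qed.

Lemma contC_const (c z : C) : contC (fun _ => c) z.
Proof. intros eps He. exists 1. split; [lra|]. intros. now rewrite Cmod_self. Qed.

Lemma contC_id (z : C) : contC (fun w => w) z.
Proof. intros eps He. now exists eps. Qed.

Lemma contC_local (f g : C -> C) (z : C) (r : R) : 0 < r ->
  (forall w, Cmod (w - z) < r -> f w = g w) -> contC g z -> contC f z.
Proof.
  intros Hr E H eps He. destruct (H eps He) as [d [Hd K]].
  exists (Rmin d r). split; [now apply Rmin_pos|]. intros w Hw.
  assert (Rmin d r <= d) by apply Rmin_l. assert (Rmin d r <= r) by apply Rmin_r.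
  rewrite !E; [apply K; lra| rewrite Cmod_self; lra | lra].
Qed.

Lemma contC_plus (f g : C -> C) (z : C) :
  contC f z -> contC g z -> contC (fun w => f w + g w)%C z.
Proof.
  intros Hf Hg eps He.
  destruct (Hf (eps / 2)) as [d [Hd K]]; [lra|].
  destruct (Hg (eps / 2)) as [d' [Hd' K']]; [lra|].
  exists (Rmin d d'). split; [now apply Rmin_pos|]. intros w Hw.
  assert (Rmin d d' <= d) by apply Rmin_l. assert (Rmin d d' <= d') by apply Rmin_r.
  replace (f w + g w - (f z + g z))%C with ((f w - f z) + (g w - g z))%C by ring.
  eapply Rle_lt_trans; [apply Cmod_triangle|].
  specialize (K w ltac:(lra)). specialize (K' w ltac:(lra)). lra.
Qed.

Lemma contC_mult (f g : C -> C) (z : C) :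
  contC f z -> contC g z -> contC (fun w => f w * g w)%C z.
Proof.
  intros Hf Hg eps He.
  set (A := Cmod (f z) + Cmod (g z) + 1).
  assert (HA : 1 <= A) by (unfold A; assert (h1 := Cmod_ge_0 (f z)); assert (h2 := Cmod_ge_0 (g z)); lra).
  assert (Hq : 0 < Rmin 1 (eps / (2 * A))).
  { apply Rmin_pos; [lra|]. apply Rdiv_lt_0_compat; lra. }
  destruct (Hf _ Hq) as [d [Hd K]].
  destruct (Hg _ Hq) as [d' [Hd' K']].
  exists (Rmin d d'). split; [now apply Rmin_pos|]. intros w Hw.
  assert (Rmin d d' <= d) by apply Rmin_l. assert (Rmin d d' <= d') by apply Rmin_r.
  specialize (K w ltac:(lra)). specialize (K' w ltac:(lra)).
  assert (L1 := Rmin_l 1 (eps / (2 * A))). assert (L2 := Rmin_r 1 (eps / (2 * A))).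
  set (q := eps / (2 * A)) in *.
  assert (Eq : q * A = eps / 2) by (unfold q; field; lra).
  replace (f w * g w - f z * g z)%C
    with ((f w - f z) * (g w - g z) + (f w - f z) * g z + f z * (g w - g z))%C by ring.
  eapply Rle_lt_trans; [apply Cmod_triangle|].
  eapply Rle_lt_trans; [apply Rplus_le_compat_r, Cmod_triangle|].
  rewrite !Cmod_mult.
  assert (h1 := Cmod_ge_0 (f z)). assert (h2 := Cmod_ge_0 (g z)).
  assert (h3 := Cmod_ge_0 (f w - f z)). assert (h4 := Cmod_ge_0 (g w - g z)).
  set (u := Cmod (f w - f z)) in *. set (v := Cmod (g w - g z)) in *.
  assert (u * v <= q * 1) by (apply Rmult_le_compat; lra).
  assert (u * Cmod (g z) <= q * Cmod (g z)) by (apply Rmult_le_compat_r; lra).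
  assert (Cmod (f z) * v <= Cmod (f z) * q) by (apply Rmult_le_compat_l; lra).
  unfold A in Eq. nra.
Qed.

Lemma contC_inv (f : C -> C) (z : C) :
  contC f z -> f z <> 0 -> contC (fun w => / f w)%C z.
Proof.
  intros Hf Hz eps He. assert (Hm := proj1 (Cmod_gt_0 _) Hz).
  set (m := Cmod (f z)) in *.
  assert (Hq : 0 < Rmin (m / 2) (eps * m * m / 2)).
  { apply Rmin_pos; [lra|]. apply Rdiv_lt_0_compat; [|lra].
    apply Rmult_lt_0_compat; [|lra]. apply Rmult_lt_0_compat; lra. }
  destruct (Hf _ Hq) as [d [Hd K]].
  exists d. split; [easy|]. intros w Hw. specialize (K w Hw).
  assert (L1 := Rmin_l (m / 2) (eps * m * m / 2)). assert (L2 := Rmin_r (m / 2) (eps * m * m / 2)).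
  assert (Hw2 : m / 2 < Cmod (f w)).
  { assert (h := Cmod_minus_ge (f z) (f w)). rewrite Cmod_minus_sym in h. fold m in h. lra. }
  assert (Hw0 : f w <> 0) by (apply Cmod_gt_0; lra).
  replace (/ f w - / f z)%C with (- (f w - f z) / (f w * f z))%C by (field; now split).
  rewrite Cmod_div by (now apply Cmult_neq_0).
  rewrite Cmod_opp, Cmod_mult. fold m.
  apply Rmult_lt_reg_r with (Cmod (f w) * m); [apply Rmult_lt_0_compat; lra|].
  unfold Rdiv. rewrite Rmult_assoc, Rinv_l, Rmult_1_r by (apply Rgt_not_eq, Rmult_lt_0_compat; lra).
  apply Rlt_le_trans with (eps * m * m / 2); [lra|].
  replace (eps * m * m / 2) with (eps * ((m / 2) * m)) by field.
  apply Rmult_le_compat_l; [lra|]. apply Rmult_le_compat_r; lra.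
Qed.

Lemma contC_comp (f g : C -> C) (z : C) :
  contC g z -> contC f (g z) -> contC (fun w => f (g w)) z.
Proof.
  intros Hg Hf eps He. destruct (Hf eps He) as [d [Hd K]].
  destruct (Hg d Hd) as [d' [Hd' K']]. exists d'. split; [easy|]. auto.
Qed.

Lemma holo_contC (f : C -> C) (z : C) : holo f z -> contC f z.
Proof.
  intros [r [phi [Hr [Hc E]]]].
  apply contC_local with (fun w => f z + phi w * (w - z))%C r; try easy.
  apply contC_plus; [apply contC_const|]. apply contC_mult; [easy|].
  apply contC_plus; [apply contC_id | apply contC_const].
Qed.

Lemma holo_local (f g : C -> C) (z : C) (r : R) : 0 < r ->
  (forall w, Cmod (w - z) < r -> f w = g w) -> holo g z -> holo f z.
Proof.
  intros Hr E [r' [phi [Hr' [Hc E']]]]. exists (Rmin r r'), phi.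
  split; [now apply Rmin_pos|]. split; [easy|]. intros w Hw.
  assert (Rmin r r' <= r) by apply Rmin_l. assert (Rmin r r' <= r') by apply Rmin_r.
  rewrite !E; [apply E'; lra | rewrite Cmod_self; lra | lra].
Qed.

Lemma holo_ext (f g : C -> C) (z : C) : (forall w, f w = g w) -> holo g z -> holo f z.
Proof. intros E. apply (holo_local _ _ _ 1); [lra|auto]. Qed.

Lemma holo_const (c z : C) : holo (fun _ => c) z.
Proof.
  exists 1, (fun _ => RtoC 0). split; [lra|]. split; [apply contC_const|]. intros. ring.
Qed.

Lemma holo_id (z : C) : holo (fun w => w) z.
Proof.
  exists 1, (fun _ => RtoC 1). split; [lra|]. split; [apply contC_const|]. intros. ring.
Qed.

Lemma holo_plus (f g : C -> C) (z : C) :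
  holo f z -> holo g z -> holo (fun w => f w + g w)%C z.
Proof.
  intros [r [phi [Hr [Hc E]]]] [r' [psi [Hr' [Hc' E']]]].
  exists (Rmin r r'), (fun w => phi w + psi w)%C.
  split; [now apply Rmin_pos|]. split; [now apply contC_plus|]. intros w Hw.
  assert (Rmin r r' <= r) by apply Rmin_l. assert (Rmin r r' <= r') by apply Rmin_r.
  rewrite E, E' by lra. ring.
Qed.

Lemma holo_mult (f g : C -> C) (z : C) :
  holo f z -> holo g z -> holo (fun w => f w * g w)%C z.
Proof.
  intros Hf Hg. assert (Hgc := holo_contC _ _ Hg).
  destruct Hf as [r [phi [Hr [Hc E]]]]. destruct Hg as [r' [psi [Hr' [Hc' E']]]].
  exists (Rmin r r'), (fun w => phi w * g w + f z * psi w)%C.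
  split; [now apply Rmin_pos|]. split.
  - apply contC_plus; apply contC_mult; try easy. apply contC_const.
  - intros w Hw.
    assert (Rmin r r' <= r) by apply Rmin_l. assert (Rmin r r' <= r') by apply Rmin_r.
    rewrite E, E' by lra. ring.
Qed.

Lemma holo_inv (f : C -> C) (z : C) :
  holo f z -> f z <> 0 -> holo (fun w => / f w)%C z.
Proof.
  intros Hf Hz. assert (Hfc := holo_contC _ _ Hf).
  destruct (Hfc (Cmod (f z))) as [d [Hd K]]; [now apply Cmod_gt_0|].
  destruct Hf as [r [phi [Hr [Hc E]]]].
  exists (Rmin r d), (fun w => - (1) * phi w * / f w * / f z)%C.
  split; [now apply Rmin_pos|]. split.
  - apply contC_mult; [|apply contC_const]. apply contC_mult; [|now apply contC_inv].
    apply contC_mult; [apply contC_const|easy].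
  - intros w Hw.
    assert (Rmin r d <= r) by apply Rmin_l. assert (Rmin r d <= d) by apply Rmin_r.
    assert (Hw0 : f w <> 0).
    { intros Z. specialize (K w ltac:(lra)). rewrite Z in K.
      rewrite Cmod_minus_sym in K. replace (f z - 0)%C with (f z) in K by ring. lra. }
    assert (Ew := E w ltac:(lra)).
    replace (- (1) * phi w * / f w * / f z * (w - z))%C
      with (- (f z + phi w * (w - z) - f z) / (f w * f z))%C by (field; now split).
    rewrite <- Ew. field. now split.
Qed.

Lemma holo_comp (f g : C -> C) (z : C) :
  holo g z -> holo f (g z) -> holo (fun w => f (g w)) z.
Proof.
  intros Hg Hf. assert (Hgc := holo_contC _ _ Hg).
  destruct Hf as [r [phi [Hr [Hc E]]]]. destruct Hg as [r' [psi [Hr' [Hc' E']]]].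
  destruct (Hgc r Hr) as [d [Hd K]].
  exists (Rmin r' d), (fun w => phi (g w) * psi w)%C.
  split; [now apply Rmin_pos|]. split.
  - apply contC_mult; [|easy]. now apply (contC_comp phi g).
  - intros w Hw.
    assert (Rmin r' d <= r') by apply Rmin_l. assert (Rmin r' d <= d) by apply Rmin_r.
    rewrite E by (apply K; lra). rewrite (E' w) at 2 by lra. ring.
Qed.

Lemma holo_minus (f g : C -> C) (z : C) :
  holo f z -> holo g z -> holo (fun w => f w - g w)%C z.
Proof.
  intros Hf Hg. apply holo_ext with (fun w => f w + - (1) * g w)%C; [intros; ring|].
  apply holo_plus; [easy|]. apply holo_mult; [apply holo_const|easy].
Qed.

Lemma holo_div (f g : C -> C) (z : C) :
  holo f z -> holo g z -> g z <> 0 -> holo (fun w => f w / g w)%C z.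
Proof. intros Hf Hg Hz. apply holo_mult; [easy|]. now apply holo_inv. Qed.

Lemma holo_pow (f : C -> C) (z : C) (n : nat) :
  holo f z -> holo (fun w => f w ^ n)%C z.
Proof.
  intros Hf. induction n as [|n IH]; simpl; [apply holo_const|]. now apply holo_mult.
Qed.

Lemma holo_C_holo_at (f : C -> C) (z : C) : holo f z -> C_holo_at f z.
Proof.
  intros [r [phi [Hr [Hc E]]]]. exists (phi z). split.
  - apply is_linear_scal_l.
  - intros x Hx.
    (* The derivative is demanded at every limit of the neighbourhood filter of z; separation leaves
       only z itself. *)
    assert (Ex : z = x) by (apply (is_filter_lim_locally_unique (V := AbsRing_NormedModule C_AbsRing)); exact Hx).
    subst x. intros eps.
    destruct (Hc eps (cond_pos eps)) as [d [Hd K]].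
    exists (mkposreal _ (Rmin_pos _ _ Hr Hd)). intros w Hw.
    change (Cmod (w - z) < Rmin r d) in Hw.
    assert (Rmin r d <= r) by apply Rmin_l. assert (Rmin r d <= d) by apply Rmin_r.
    change (Cmod (f w - f z - (w - z) * phi z)%C <= eps * Cmod (w - z)%C).
    rewrite E by lra.
    replace (f z + phi w * (w - z) - f z - (w - z) * phi z)%C with ((phi w - phi z) * (w - z))%C by ring.
    rewrite Cmod_mult. apply Rmult_le_compat_r; [apply Cmod_ge_0|].
    left. apply K. lra.
Qed.

Ltac holo_auto := repeat first
  [ apply holo_const | apply holo_id | apply holo_minus | apply holo_plus
  | apply holo_div | apply holo_pow | apply holo_mult | assumption ].

(** * Series of complex functions *)

(** Total: a divergent component receives the default value of the real [Series], so the linearity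
    lemmas assume [summable]. *)
Definition CSeries (a : nat -> C) : C :=
  (Series (fun n => Re (a n)), Series (fun n => Im (a n))).

Definition summable (a : nat -> C) : Prop := ex_series (fun n => Cmod (a n)).

Lemma summable_le (a : nat -> C) (M : nat -> R) :
  (forall n, Cmod (a n) <= M n) -> ex_series M -> summable a.
Proof.
  intros H. apply (ex_series_le (fun n => Cmod (a n))). intros n.
  change (Rabs (Cmod (a n)) <= M n). rewrite Rabs_pos_eq; [easy|apply Cmod_ge_0].
Qed.

Lemma summable_Re (a : nat -> C) : summable a -> ex_series (fun n => Re (a n)).
Proof. apply (ex_series_le (fun n => Re (a n))). intros n. apply re_le_Cmod. Qed.

Lemma summable_Im (a : nat -> C) : summable a -> ex_series (fun n => Im (a n)).
Proof. apply (ex_series_le (fun n => Im (a n))). intros n. apply Im_le_Cmod. Qed.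

Lemma sum_n_C (a : nat -> C) (n : nat) :
  @sum_n C_AbelianMonoid a n = (sum_n (fun k => Re (a k)) n, sum_n (fun k => Im (a k)) n).
Proof.
  induction n as [|n IH].
  - rewrite !sum_O. now destruct (a 0%nat).
  - rewrite !sum_Sn, IH. now destruct (a (S n)).
Qed.

Lemma is_series_C (a : nat -> C) (l : C) :
  is_series (fun n => Re (a n)) (Re l) -> is_series (fun n => Im (a n)) (Im l) ->
  @is_series C_AbsRing C_NormedModule a l.
Proof.
  intros H1 H2. unfold is_series in *.
  apply filterlim_ext with (fun n => (sum_n (fun k => Re (a k)) n, sum_n (fun k => Im (a k)) n)).
  - intros n. symmetry. apply sum_n_C.
  - intros P [eps HP].
    assert (K1 := proj1 (filterlim_locally _ _) H1 eps).
    assert (K2 := proj1 (filterlim_locally _ _) H2 eps).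
    unfold filtermap. generalize (filter_and _ _ K1 K2). apply filter_imp. intros n [h1 h2]. apply HP. now split.
Qed.

Lemma CSeries_correct (a : nat -> C) :
  summable a -> @is_series C_AbsRing C_NormedModule a (CSeries a).
Proof.
  intros H. apply is_series_C; apply Series_correct; [now apply summable_Re|now apply summable_Im].
Qed.

Lemma CSeries_ext (a b : nat -> C) : (forall n, a n = b n) -> CSeries a = CSeries b.
Proof. intros E. unfold CSeries. f_equal; apply Series_ext; intros; now rewrite E. Qed.

Lemma summable_ext (a b : nat -> C) : (forall n, a n = b n) -> summable a -> summable b.
Proof. intros E. apply ex_series_ext. intros; now rewrite E. Qed.

Lemma summable_plus (a b : nat -> C) :
  summable a -> summable b -> summable (fun n => a n + b n)%C.
Proof.
  intros Ha Hb. apply summable_le with (fun n => Cmod (a n) + Cmod (b n)).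
  - intros. apply Cmod_triangle.
  - now apply (ex_series_plus (fun n => Cmod (a n)) (fun n => Cmod (b n))).
Qed.

Lemma summable_scal (c : C) (a : nat -> C) :
  summable a -> summable (fun n => c * a n)%C.
Proof.
  intros Ha. apply summable_le with (fun n => Cmod c * Cmod (a n)).
  - intros. rewrite Cmod_mult. lra.
  - now apply (ex_series_scal (Cmod c) (fun n => Cmod (a n))).
Qed.

Lemma CSeries_plus (a b : nat -> C) : summable a -> summable b ->
  CSeries (fun n => a n + b n)%C = (CSeries a + CSeries b)%C.
Proof.
  intros Ha Hb. unfold CSeries, Cplus; simpl.
  f_equal; apply Series_plus; auto using summable_Re, summable_Im.
Qed.

Lemma CSeries_scal (c : C) (a : nat -> C) : summable a ->
  CSeries (fun n => c * a n)%C = (c * CSeries a)%C.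
Proof.
  intros Ha. assert (h1 := summable_Re _ Ha). assert (h2 := summable_Im _ Ha).
  unfold CSeries, Cmult, Re, Im in *; simpl. f_equal.
  - rewrite <- !Series_scal_l. rewrite <- Series_minus; [easy| |];
      now apply @ex_series_scal.
  - rewrite <- !Series_scal_l. rewrite <- Series_plus; [easy| |];
      now apply @ex_series_scal.
Qed.

Lemma CSeries_minus (a b : nat -> C) : summable a -> summable b ->
  CSeries (fun n => a n - b n)%C = (CSeries a - CSeries b)%C.
Proof.
  intros Ha Hb. rewrite (CSeries_ext _ (fun n => a n + - (1) * b n)%C) by (intros; ring).
  rewrite CSeries_plus, CSeries_scal; auto using summable_scal. ring.
Qed.

Lemma CSeries_incr_1 (a : nat -> C) : summable a ->
  CSeries a = (a 0%nat + CSeries (fun n => a (S n)))%C.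
Proof.
  intros Ha. unfold CSeries, Cplus; simpl.
  f_equal; apply Series_incr_1; auto using summable_Re, summable_Im.
Qed.

Lemma summable_incr_1 (a : nat -> C) : summable a <-> summable (fun n => a (S n)).
Proof. apply (ex_series_incr_1 (fun n => Cmod (a n))). Qed.

(** The factor 2 is the price of bounding real and imaginary parts separately; only summability
    matters later, so it is harmless. *)
Lemma Cmod_CSeries_le (a : nat -> C) (M : nat -> R) :
  (forall n, Cmod (a n) <= M n) -> ex_series M -> Cmod (CSeries a) <= 2 * Series M.
Proof.
  intros H HM. assert (Ha := summable_le _ _ H HM).
  assert (Hb : Series (fun n => Cmod (a n)) <= Series M).
  { apply Series_le; [|easy]. intros n. split; [apply Cmod_ge_0|apply H]. }
  eapply Rle_trans; [apply Cmod_le_Re_Im|]. unfold CSeries, Re at 1, Im at 1; simpl.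
  assert (B : forall p : C -> R, (forall z, Rabs (p z) <= Cmod z) ->
    Rabs (Series (fun n => p (a n))) <= Series M).
  { intros p Hp. eapply Rle_trans; [apply Series_Rabs|].
    - apply (ex_series_le (fun n => Rabs (p (a n))) (fun n => Cmod (a n))); [|easy].
      intros n. change (Rabs (Rabs (p (a n))) <= Cmod (a n)). rewrite Rabs_Rabsolu. apply Hp.
    - eapply Rle_trans; [|apply Hb]. apply Series_le; [|easy].
      intros n. split; [apply Rabs_pos|apply Hp]. }
  assert (h1 := B Re re_le_Cmod). assert (h2 := B Im Im_le_Cmod). lra.
Qed.

Lemma series_tail_small (M : nat -> R) (eps : R) : ex_series M -> 0 < eps ->
  exists N, Rabs (Series (fun n => M (N + n)%nat)) < eps.
Proof.
  intros HM He. assert (h := Series_correct _ HM).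
  apply (is_lim_seq_spec _ (Series M)) in h.
  destruct (h (mkposreal eps He)) as [N HN]. specialize (HN N (le_n _)).
  exists (S N). rewrite (Series_incr_n M (S N)) in HN by (try lia; easy). simpl pred in HN.
  rewrite sum_n_Reals in HN. simpl in HN |- *.
  rewrite Rabs_minus_sym in HN.
  replace (sum_f_R0 M N + Series (fun k : nat => M (S (N + k))) - sum_f_R0 M N)
   with (Series (fun k : nat => M (S (N + k)))) in HN by ring. exact HN.
Qed.

Fixpoint Csum (a : nat -> C) (n : nat) : C :=
  match n with O => RtoC 0 | S m => (Csum a m + a m)%C end.

Lemma CSeries_incr_n (a : nat -> C) (n : nat) : summable a ->
  CSeries a = (Csum a n + CSeries (fun k => a (n + k)%nat))%C
  /\ summable (fun k => a (n + k)%nat).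
Proof.
  intros Ha. induction n as [|n [IH Hs]]; simpl.
  - split; [|easy]. rewrite Cplus_0_l. now apply CSeries_ext.
  - split.
    + rewrite IH, (CSeries_incr_1 _ Hs), Nat.add_0_r, <- Cplus_assoc. do 2 f_equal.
      apply CSeries_ext. intros k. f_equal. lia.
    + apply summable_incr_1 in Hs. apply summable_ext with (2 := Hs).
      intros k. f_equal. lia.
Qed.

(** * Termwise continuity and differentiability of series *)

Lemma contC_Csum (f : nat -> C -> C) (z : C) (N : nat) :
  (forall n, contC (f n) z) -> contC (fun w => Csum (fun n => f n w) N) z.
Proof.
  intros H. induction N as [|N IH]; simpl; [apply contC_const|now apply contC_plus].
Qed.

Lemma holo_Csum (f : nat -> C -> C) (z : C) (N : nat) :
  (forall n, (n < N)%nat -> holo (f n) z) -> holo (fun w => Csum (fun n => f n w) N) z.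
Proof.
  intros H. induction N as [|N IH]; simpl; [apply holo_const|].
  apply holo_plus; [apply IH; intros; apply H; lia | apply H; lia].
Qed.

Lemma contC_CSeries (f : nat -> C -> C) (M : nat -> R) (z : C) (r : R) :
  0 < r -> (forall n, contC (f n) z) -> ex_series M ->
  (forall n w, Cmod (w - z) < r -> Cmod (f n w) <= M n) ->
  contC (fun w => CSeries (fun n => f n w)) z.
Proof.
  intros Hr Hc HM HB eps He.
  (* The factor 2 of [Cmod_CSeries_le] turns this into eps/4 for each of the two tails; the partial
     sums take the other half. *)
  destruct (series_tail_small M (eps / 8) HM) as [N HN]; [lra|].
  destruct (contC_Csum f z N Hc (eps / 2)) as [d [Hd K]]; [lra|].
  exists (Rmin d r). split; [now apply Rmin_pos|]. intros w Hw.
  assert (Rmin d r <= d) by apply Rmin_l. assert (Rmin d r <= r) by apply Rmin_r.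
  assert (HMN : ex_series (fun n => M (N + n)%nat)) by (now apply ex_series_incr_n).
  assert (T : forall v, Cmod (v - z) < r ->
    CSeries (fun n => f n v) = (Csum (fun n => f n v) N + CSeries (fun n => f (N + n)%nat v))%C
    /\ Cmod (CSeries (fun n => f (N + n)%nat v)) < eps / 4).
  { intros v Hv. split.
    - apply (CSeries_incr_n (fun n => f n v)). apply summable_le with M; auto.
    - eapply Rle_lt_trans.
      + apply (Cmod_CSeries_le _ (fun n => M (N + n)%nat)); [intros n; now apply HB|easy].
      + assert (h := Rle_abs (Series (fun n => M (N + n)%nat))). lra. }
  destruct (T w) as [Ew Bw]; [lra|]. destruct (T z) as [Ez Bz]; [rewrite Cmod_self; lra|].
  rewrite Ew, Ez. specialize (K w ltac:(lra)).
  set (p := CSeries (fun n => f (N + n)%nat w)) in *. set (q := CSeries (fun n => f (N + n)%nat z)) in *.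
  set (u := Csum _ N) in *. set (v := Csum (fun n => f n z) N) in *.
  replace (u + p - (v + q))%C with ((u - v) + (p - q))%C by ring.
  eapply Rle_lt_trans; [apply Cmod_triangle|].
  assert (h := Cmod_minus_le p q). lra.
Qed.

(** Weaker than a Lipschitz condition on the disc: one of the two points is always the centre, which
    is all that the Caratheodory quotient at z sees. *)
Definition lip_at (f : C -> C) (z : C) (r M : R) : Prop :=
  forall w, Cmod (w - z) < r ->
    Cmod (f w) <= M /\ Cmod (f w - f z) <= M * Cmod (w - z).

(** The Caratheodory quotient of the sum is the sum of the quotients; these are continuous at z and
    dominated by M, so their sum is continuous at z as well. *)
Lemma holo_CSeries_uniform (f : nat -> C -> C) (M : nat -> R) (z : C) (r : R) :
  0 < r -> (forall n, holo (f n) z) -> ex_series M ->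
  (forall n, lip_at (f n) z r (M n)) ->
  holo (fun w => CSeries (fun n => f n w)) z.
Proof.
  intros Hr Hf HM HL.
  assert (HQ : forall n, exists psi : C -> C, contC psi z /\
    (forall w, f n w = f n z + psi w * (w - z))%C /\
    forall w, Cmod (w - z) < r -> Cmod (psi w) <= M n).
  { intros n. destruct (Hf n) as [r' [phi [Hr' [Hc E]]]].
    (* [phi] is known only within a radius depending on n; the difference quotient extends it to the
       common disc of radius r. *)
    set (psi := fun w => if excluded_middle_informative (w = z) then phi z
                else ((f n w - f n z) / (w - z))%C).
    assert (Hpc : contC psi z).
    { apply contC_local with phi r'; [easy| |easy]. intros w Hw. unfold psi.
      destruct (excluded_middle_informative (w = z)) as [->|Hn]; [easy|].
      rewrite (E w Hw). field. now apply Cminus_neq_0. }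
    assert (Hpe : forall w, (f n w = f n z + psi w * (w - z))%C).
    { intros w. unfold psi. destruct (excluded_middle_informative (w = z)) as [->|Hn]; [ring|].
      field. now apply Cminus_neq_0. }
    assert (Hpb : forall w, w <> z -> Cmod (w - z) < r -> Cmod (psi w) <= M n).
    { intros w Hn Hw. assert (Hd := proj1 (Cmod_gt_0 _) (Cminus_neq_0 _ _ Hn)).
      apply Rmult_le_reg_r with (Cmod (w - z)); [easy|]. rewrite <- Cmod_mult.
      replace (psi w * (w - z))%C with (f n w - f n z)%C by (rewrite (Hpe w); ring).
      now apply HL. }
    exists psi. split; [easy|]. split; [easy|]. intros w Hw.
    destruct (excluded_middle_informative (w = z)) as [->|Hn]; [|now apply Hpb].
    (* At z itself the bound is inherited by continuity: a value above M n would persist at the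
       nearby point z + e. *)
    apply Rnot_lt_le. intros Hlt.
    destruct (Hpc (Cmod (psi z) - M n)) as [d [Hd K]]; [lra|].
    set (e := Rmin d r / 2).
    assert (He : 0 < e) by (unfold e; assert (h := Rmin_pos _ _ Hd Hr); lra).
    assert (He1 : e < d) by (unfold e in *; assert (h := Rmin_l d r); lra).
    assert (He2 : e < r) by (unfold e in *; assert (h := Rmin_r d r); lra).
    assert (Ee : Cmod (z + e - z) = e).
    { replace (z + e - z)%C with (RtoC e) by ring. rewrite Cmod_R. apply Rabs_pos_eq. lra. }
    specialize (K (z + e)%C ltac:(lra)).
    assert (h : Cmod (psi (z + e)%C) <= M n).
    { apply Hpb; [|lra]. intros E0. rewrite E0, Cmod_self in Ee. lra. }
    assert (h' := Cmod_minus_ge (psi z) (psi (z + e)%C)).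
    rewrite Cmod_minus_sym in h'. lra. }
  set (psi := fun n => proj1_sig (constructive_indefinite_description _ (HQ n))).
  assert (Hpsi := fun n => proj2_sig (constructive_indefinite_description _ (HQ n))).
  fold psi in Hpsi. change (forall n, contC (psi n) z /\
    (forall w, f n w = f n z + psi n w * (w - z))%C /\
    forall w, Cmod (w - z) < r -> Cmod (psi n w) <= M n) in Hpsi.
  exists r, (fun w => CSeries (fun n => psi n w)). split; [easy|]. split.
  - apply contC_CSeries with M r; try easy; intros n; apply Hpsi.
  - intros w Hw.
    assert (S1 : summable (fun n => psi n w)).
    { apply summable_le with M; [|easy]. intros n. now apply Hpsi. }
    assert (S2 : summable (fun n => f n z)).
    { apply summable_le with M; [|easy]. intros n. apply (HL n). rewrite Cmod_self. lra. }
    rewrite Cmult_comm, <- CSeries_scal, <- CSeries_plus by auto using summable_scal.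
    apply CSeries_ext. intros n. destruct (Hpsi n) as [_ [E _]]. rewrite (E w). ring.
Qed.

(** Allows finitely many terms without a bound, such as the terms of G for which 2 pi n^2 is not
    large compared with |t|. *)
Lemma holo_CSeries (f : nat -> C -> C) (M : nat -> R) (z : C) (r : R) (N : nat) :
  0 < r -> (forall n, holo (f n) z) -> ex_series M ->
  (forall n, (N <= n)%nat -> lip_at (f n) z r (M n)) ->
  holo (fun w => CSeries (fun n => f n w)) z.
Proof.
  intros Hr Hf HM HL.
  assert (HMN : ex_series (fun n => M (N + n)%nat)) by (now apply ex_series_incr_n).
  apply holo_local with (fun w => Csum (fun n => f n w) N + CSeries (fun n => f (N + n)%nat w))%C r; [easy| |].
  - intros w Hw. apply (CSeries_incr_n (fun n => f n w)).
    assert (Hs : summable (fun n => f (N + n)%nat w)).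
    { apply summable_le with (fun n => M (N + n)%nat); [|easy]. intros n. apply HL; [lia|easy]. }
    apply (ex_series_incr_n (fun n => Cmod (f n w)) N). exact Hs.
  - apply holo_plus; [apply holo_Csum; auto|].
    apply (holo_CSeries_uniform (fun n => f (N + n)%nat) (fun n => M (N + n)%nat) z r); auto.
    intros n. apply HL. lia.
Qed.

Lemma lip_at_mult (f g : C -> C) (z : C) (r A B : R) : 0 < r ->
  lip_at f z r A -> lip_at g z r B -> lip_at (fun w => f w * g w)%C z r (2 * A * B).
Proof.
  intros Hr Hf Hg w Hw. destruct (Hf w Hw) as [f1 f2]. destruct (Hg w Hw) as [g1 g2].
  assert (Hz : Cmod (z - z) < r) by (rewrite Cmod_self; lra).
  destruct (Hf z Hz) as [f3 _].
  assert (a0 := Cmod_ge_0 (f w)). assert (b0 := Cmod_ge_0 (g w)). assert (d0 := Cmod_ge_0 (w - z)).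
  rewrite Cmod_mult. split.
  - assert (Cmod (f w) * Cmod (g w) <= A * B) by (apply Rmult_le_compat; lra).
    assert (0 <= A * B) by (apply Rmult_le_pos; lra). lra.
  - replace (f w * g w - f z * g z)%C with ((f w - f z) * g w + f z * (g w - g z))%C by ring.
    eapply Rle_trans; [apply Cmod_triangle|]. rewrite !Cmod_mult.
    assert (Cmod (f w - f z) * Cmod (g w) <= A * Cmod (w - z) * B)
      by (apply Rmult_le_compat; try lra; apply Cmod_ge_0).
    assert (Cmod (f z) * Cmod (g w - g z) <= A * (B * Cmod (w - z)))
      by (apply Rmult_le_compat; try lra; apply Cmod_ge_0).
    lra.
Qed.

(** Serves the substitutions s -> 1 - s, e -> e - 1 and t -> -1/2 - it, which leave radius and
    constant unchanged. *)
Lemma lip_at_isometry (f g : C -> C) (z : C) (r M : R) :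
  (forall w, Cmod (g w - g z) = Cmod (w - z)) ->
  lip_at f (g z) r M -> lip_at (fun w => f (g w)) z r M.
Proof. intros Hg Hf w Hw. rewrite <- Hg in *. now apply Hf. Qed.

Lemma lip_at_weaken (f : C -> C) (z : C) (r r' M : R) :
  r' <= r -> lip_at f z r M -> lip_at f z r' M.
Proof. intros Hr H w Hw. apply H. lra. Qed.

Lemma CSeries_telescope (u : nat -> C) :
  is_lim_seq (fun n => Cmod (u n)) 0 ->
  CSeries (fun n => u (S n) - u n)%C = (- u 0%nat)%C.
Proof.
  intros Hu.
  assert (T : forall p : C -> R, (forall a b, p (a - b)%C = p a - p b) ->
     (forall a, Rabs (p a) <= Cmod a) ->
     Series (fun n => p (u (S n) - u n)%C) = - p (u 0%nat)).
  { intros p Hp Hb. apply is_series_unique.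
    change (is_lim_seq (sum_n (fun n => p (u (S n) - u n)%C)) (- p (u 0%nat))).
    apply is_lim_seq_ext with (fun n => p (u (S n)) - p (u 0%nat)).
    - intros n. induction n as [|n IH]; [now rewrite sum_O, Hp|].
      rewrite sum_Sn, <- IH, Hp. unfold plus; simpl. ring.
    - replace (Finite (- p (u 0%nat))) with (Finite (0 - p (u 0%nat))) by (f_equal; ring).
      apply is_lim_seq_minus'; [|apply is_lim_seq_const].
      apply (is_lim_seq_incr_1 (fun n => p (u n))).
      apply is_lim_seq_abs_0. apply is_lim_seq_le_le with (fun _ => 0) (fun n => Cmod (u n)).
      + intros n. split; [apply Rabs_pos|apply Hb].
      + apply is_lim_seq_const.
      + exact Hu. }
  unfold CSeries. rewrite (T Re (fun a b => eq_refl) re_le_Cmod).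
  rewrite (T Im (fun a b => eq_refl) Im_le_Cmod). reflexivity.
Qed.

Lemma Csum_ext (a b : nat -> C) (n : nat) :
  (forall k, (k < n)%nat -> a k = b k) -> Csum a n = Csum b n.
Proof.
  intros H. induction n as [|n IH]; [easy|]. simpl.
  rewrite IH, H by (intros; try apply H; lia). reflexivity.
Qed.

(** * Complex-valued functions of a real variable *)

Definition derivC (f : R -> C) (x : R) (l : C) : Prop :=
  is_derive (fun y => Re (f y)) x (Re l) /\ is_derive (fun y => Im (f y)) x (Im l).

Lemma derivC_ext (f g : R -> C) (x : R) (l : C) :
  (forall y, f y = g y) -> derivC f x l -> derivC g x l.
Proof.
  intros E [H1 H2]. split; [apply is_derive_ext with (2 := H1)|apply is_derive_ext with (2 := H2)];
    intros t; simpl; now rewrite E.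
Qed.

Lemma derivC_const (c : C) (x : R) : derivC (fun _ => c) x 0.
Proof. split; apply (@is_derive_const R_AbsRing R_NormedModule). Qed.

Lemma derivC_minus (f g : R -> C) (x : R) (l m : C) :
  derivC f x l -> derivC g x m -> derivC (fun y => f y - g y)%C x (l - m)%C.
Proof.
  intros [f1 f2] [g1 g2].
  split; [exact (is_derive_minus _ _ _ _ _ f1 g1) | exact (is_derive_minus _ _ _ _ _ f2 g2)].
Qed.

Lemma derivC_scal (c : C) (f : R -> C) (x : R) (l : C) :
  derivC f x l -> derivC (fun y => c * f y)%C x (c * l)%C.
Proof.
  intros [f1 f2]. split.
  - exact (is_derive_minus _ _ _ _ _ (is_derive_scal _ _ (Re c) _ f1) (is_derive_scal _ _ (Im c) _ f2)).
  - exact (is_derive_plus _ _ _ _ _ (is_derive_scal _ _ (Re c) _ f2) (is_derive_scal _ _ (Im c) _ f1)).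
Qed.

Lemma derivC_RtoC (g : R -> R) (x l : R) : is_derive g x l -> derivC (fun y => RtoC (g y)) x (RtoC l).
Proof. intros H. split; [exact H|]. apply (@is_derive_const R_AbsRing R_NormedModule 0). Qed.

Lemma derivC_Cexp (c : C) (g : R -> R) (x l : R) : is_derive g x l ->
  derivC (fun y => Cexp (c * g y))%C x (c * l * Cexp (c * g x))%C.
Proof.
  intros H. destruct c as [a b]. unfold derivC, Cexp, Cmult, RtoC, Re, Im; simpl.
  assert (X : ex_derive g x) by now exists l.
  split; auto_derive; try (repeat apply conj; easy);
    change (Derive (fun y => g y) x) with (Derive g x); rewrite (is_derive_unique _ _ _ H);
    unfold Rminus; ring.
Qed.

(** The mean value equality fails for complex values; it is applied to real and imaginary parts,
    whence the factor 2. *)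
Lemma mean_value_C (f f' : R -> C) (x B : R) : 0 <= x ->
  (forall y, 0 <= y <= x -> derivC f y (f' y)) ->
  (forall y, 0 <= y <= x -> Cmod (f' y) <= B) ->
  Cmod (f x - f 0) <= 2 * B * x.
Proof.
  intros Hx Hd HB.
  assert (MV : forall p : C -> R, (forall u v, p (u - v)%C = p u - p v) ->
     (forall u, Rabs (p u) <= Cmod u) ->
     (forall y, 0 <= y <= x -> is_derive (fun y => p (f y)) y (p (f' y))) ->
     Rabs (p (f x - f 0)%C) <= B * x).
  { intros p Hp Hm Hpd.
    destruct (MVT_gen (fun y => p (f y)) 0 x (fun y => p (f' y))) as [c [Hc E]].
    - intros y Hy. rewrite Rmin_left, Rmax_right in Hy by easy. apply Hpd. lra.
    - intros y Hy. rewrite Rmin_left, Rmax_right in Hy by easy.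
      apply continuity_pt_filterlim. apply (ex_derive_continuous (fun y => p (f y))).
      eexists. apply Hpd. lra.
    - rewrite Rmin_left, Rmax_right in Hc by easy.
      rewrite Hp, E, Rminus_0_r, Rabs_mult, (Rabs_pos_eq x) by easy.
      apply Rmult_le_compat_r; [easy|]. eapply Rle_trans; [apply Hm|]. now apply HB. }
  eapply Rle_trans; [apply Cmod_le_Re_Im|].
  assert (h1 := MV Re (fun u v => eq_refl) re_le_Cmod (fun y Hy => proj1 (Hd y Hy))).
  assert (h2 := MV Im (fun u v => eq_refl) Im_le_Cmod (fun y Hy => proj2 (Hd y Hy))).
  lra.
Qed.

(** Integration in x carries bounds in the parameter e from F' to F and gains a factor x. This gain
    drives the induction on the order of the binomial remainder. *)
Lemma lip_at_mean_value (F F' : C -> R -> C) (e0 : C) (r x B : R) : 0 <= x -> 0 < r ->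
  (forall e, F e 0 = 0) ->
  (forall e y, 0 <= y <= x -> derivC (F e) y (F' e y)) ->
  (forall y, 0 <= y <= x -> lip_at (fun e => F' e y) e0 r B) ->
  lip_at (fun e => F e x) e0 r (2 * B * x).
Proof.
  intros Hx Hr H0 Hd HL e He. split.
  - replace (F e x) with (F e x - F e 0)%C by (rewrite H0; ring).
    apply mean_value_C with (F' e); try easy; [now intros; apply Hd|]. intros y Hy. now apply (HL y Hy).
  (* The mean value inequality is applied to the difference F e - F e0, which vanishes at 0. *)
  - replace (F e x - F e0 x)%C with ((F e x - F e0 x) - (F e 0 - F e0 0))%C by (rewrite !H0; ring).
    eapply Rle_trans.
    + apply (mean_value_C (fun y => F e y - F e0 y)%C (fun y => F' e y - F' e0 y)%C x (B * Cmod (e - e0))); [easy| |].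
      * intros y Hy. apply derivC_minus; now apply Hd.
      * intros y Hy. now apply (HL y Hy).
    + right. ring.
Qed.

(** * The complex exponential *)

Lemma Cexp_plus (z w : C) : Cexp (z + w) = (Cexp z * Cexp w)%C.
Proof.
  destruct z as [a b], w as [c d]. unfold Cexp, Cplus, Cmult, Re, Im; simpl.
  rewrite exp_plus, cos_plus, sin_plus. f_equal; ring.
Qed.

Lemma Cexp_RtoC (x : R) : Cexp (RtoC x) = RtoC (exp x).
Proof. unfold Cexp, RtoC, Re, Im; simpl. rewrite cos_0, sin_0. f_equal; ring. Qed.

Lemma Cexp_0 : Cexp 0 = 1.
Proof. rewrite Cexp_RtoC. now rewrite exp_0. Qed.

Lemma Cmod_Cexp (z : C) : Cmod (Cexp z) = exp (Re z).
Proof.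
  unfold Cmod, Cexp; simpl.
  replace (exp (Re z) * cos (Im z) * (exp (Re z) * cos (Im z) * 1) +
     exp (Re z) * sin (Im z) * (exp (Re z) * sin (Im z) * 1))
   with (Rsqr (exp (Re z)) * (Rsqr (sin (Im z)) + Rsqr (cos (Im z)))) by (unfold Rsqr; ring).
  rewrite sin2_cos2, Rmult_1_r. apply sqrt_Rsqr. left. apply exp_pos.
Qed.

Lemma Cexp_neq_0 (z : C) : Cexp z <> 0.
Proof. apply Cmod_gt_0. rewrite Cmod_Cexp. apply exp_pos. Qed.

Lemma exp_le_compat (x y : R) : x <= y -> exp x <= exp y.
Proof. intros [H| ->]; [left; now apply exp_increasing|lra]. Qed.

Lemma Cmod_Cexp_le (z : C) : Cmod (Cexp z) <= exp (Cmod z).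
Proof.
  rewrite Cmod_Cexp. apply exp_le_compat.
  eapply Rle_trans; [apply Rle_abs|apply re_le_Cmod].
Qed.

(** Each Taylor bound follows from the preceding one by the mean value inequality along the segment
    from 0 to z, which doubles the constant. The parameter u makes the bound available on the whole
    segment for the next order. *)
Lemma Cexp_taylor_1 (z : C) (u : R) : 0 <= u <= 1 ->
  Cmod (Cexp (z * u) - 1) <= 2 * (Cmod z * exp (Cmod z)).
Proof.
  intros Hu.
  replace (Cexp (z * u) - 1)%C with (Cexp (z * u) - Cexp (z * 0))%C
    by (rewrite Cmult_0_r, Cexp_0; reflexivity).
  eapply Rle_trans.
  - apply (mean_value_C (fun y => Cexp (z * y)) (fun y => z * 1 * Cexp (z * y))%C u (Cmod z * exp (Cmod z))); [easy| |].
    + intros y Hy. apply (derivC_Cexp z (fun t => t)). apply (@is_derive_id R_AbsRing).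
    + intros y Hy. rewrite !Cmod_mult, Cmod_1, Rmult_1_r.
      apply Rmult_le_compat_l; [apply Cmod_ge_0|]. eapply Rle_trans; [apply Cmod_Cexp_le|].
      apply exp_le_compat. rewrite Cmod_mult, Cmod_R, Rabs_pos_eq by easy.
      assert (h := Cmod_ge_0 z). nra.
  - assert (0 <= Cmod z * exp (Cmod z)) by (apply Rmult_le_pos; [apply Cmod_ge_0|left; apply exp_pos]).
    nra.
Qed.

Lemma Cexp_minus_1_bound (z : C) : Cmod (Cexp z - 1) <= 2 * (Cmod z * exp (Cmod z)).
Proof.
  assert (h := Cexp_taylor_1 z 1 ltac:(lra)). now rewrite Cmult_1_r in h.
Qed.

Lemma Cexp_taylor_2 (z : C) (u : R) : 0 <= u <= 1 ->
  Cmod (Cexp (z * u) - 1 - z * u) <= 4 * (Cmod z * Cmod z * exp (Cmod z)).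
Proof.
  intros Hu.
  replace (Cexp (z * u) - 1 - z * u)%C with ((Cexp (z * u) - 1 - z * u) - (Cexp (z * 0) - 1 - z * 0))%C
    by (rewrite Cmult_0_r, Cexp_0; ring).
  eapply Rle_trans.
  - apply (mean_value_C (fun y => Cexp (z * y) - 1 - z * y)%C (fun y => z * 1 * Cexp (z * y) - 0 - z * 1)%C u
      (Cmod z * (2 * (Cmod z * exp (Cmod z))))); [easy| |].
    + intros y Hy. apply derivC_minus; [apply derivC_minus|].
      * apply (derivC_Cexp z (fun t => t)). apply (@is_derive_id R_AbsRing).
      * apply derivC_const.
      * apply derivC_scal, derivC_RtoC. apply (@is_derive_id R_AbsRing).
    + intros y Hy. replace (z * 1 * Cexp (z * y) - 0 - z * 1)%C with (z * (Cexp (z * y) - 1))%C by ring.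
      rewrite Cmod_mult. apply Rmult_le_compat_l; [apply Cmod_ge_0|]. apply Cexp_taylor_1. lra.
  - assert (0 <= Cmod z * Cmod z * exp (Cmod z))
      by (repeat apply Rmult_le_pos; try apply Cmod_ge_0; left; apply exp_pos).
    nra.
Qed.

Lemma Cexp_taylor_3 (z : C) :
  Cmod (Cexp z - 1 - z - z * z / 2) <= 8 * (Cmod z * Cmod z * Cmod z * exp (Cmod z)).
Proof.
  assert (E : (Cexp z - 1 - z - z * z / 2 =
    (Cexp (z * 1%R) - 1 - z * 1%R - z * z / 2 * RtoC (1 * 1)) -
    (Cexp (z * 0%R) - 1 - z * 0%R - z * z / 2 * RtoC (0 * 0)))%C).
  { rewrite !Rmult_1_r, !Rmult_0_r, !Cmult_0_r, !Cmult_1_r, Cexp_0. ring. }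
  rewrite E.
  eapply Rle_trans.
  - apply (mean_value_C (fun y => Cexp (z * y) - 1 - z * y - z * z / 2 * RtoC (y * y))%C
      (fun y => z * 1 * Cexp (z * y) - 0 - z * 1 - z * z / 2 * RtoC (2 * y))%C 1
      (Cmod z * (4 * (Cmod z * Cmod z * exp (Cmod z))))); [lra| |].
    + intros y Hy. apply derivC_minus; [apply derivC_minus; [apply derivC_minus|]|].
      * apply (derivC_Cexp z (fun t => t)). apply (@is_derive_id R_AbsRing).
      * apply derivC_const.
      * apply derivC_scal, derivC_RtoC. apply (@is_derive_id R_AbsRing).
      * apply derivC_scal, (derivC_RtoC (fun y => y * y)). auto_derive; [easy|ring].
    + intros y Hy.
      replace (z * 1 * Cexp (z * y) - 0 - z * 1 - z * z / 2 * RtoC (2 * y))%C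
        with (z * (Cexp (z * y) - 1 - z * y))%C.
      * rewrite Cmod_mult. apply Rmult_le_compat_l; [apply Cmod_ge_0|]. apply Cexp_taylor_2. lra.
      * rewrite RtoC_mult. field.
  - right. ring.
Qed.

Definition expq (z : C) : C :=
  if excluded_middle_informative (z = 0) then 1 else ((Cexp z - 1) / z)%C.

Lemma expq_0 : expq 0 = 1.
Proof. unfold expq. now destruct (excluded_middle_informative _). Qed.

Lemma expq_spec (z : C) : Cexp z = (1 + z * expq z)%C.
Proof.
  unfold expq. destruct (excluded_middle_informative (z = 0)) as [->|H].
  - rewrite Cexp_0. ring.
  - field. exact H.
Qed.

(** The derivative at 0 is 1/2, and (expq w - 1)/w - 1/2 equals (exp w - 1 - w - w^2/2)/w^2. The
    third-order Taylor bound makes this O(|w|). *)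
Lemma holo_expq_0 : holo expq 0.
Proof.
  exists 1, (fun w : C => if excluded_middle_informative (w = 0) then / 2 else ((expq w - 1) / w))%C.
  split; [lra|]. split.
  - intros eps He. set (A := 8 * exp 1). assert (HA : 0 < A) by (unfold A; assert (h := exp_pos 1); lra).
    exists (Rmin 1 (eps / A)). split; [apply Rmin_pos; [lra|now apply Rdiv_lt_0_compat]|].
    intros w Hw. replace (w - 0)%C with w in Hw by ring.
    assert (L1 := Rmin_l 1 (eps / A)). assert (L2 := Rmin_r 1 (eps / A)).
    destruct (excluded_middle_informative (RtoC 0 = 0)) as [_|n]; [|now destruct n].
    destruct (excluded_middle_informative (w = 0)) as [->|Hn].
    { rewrite Cmod_self. lra. }
    replace ((expq w - 1) / w - / 2)%C with ((Cexp w - 1 - w - w * w / 2) / (w * w))%C.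
    2:{ rewrite expq_spec. field. exact Hn. }
    assert (Hm := proj1 (Cmod_gt_0 _) Hn).
    rewrite Cmod_div by (now apply Cmult_neq_0). rewrite Cmod_mult.
    apply Rmult_lt_reg_r with (Cmod w * Cmod w); [nra|].
    unfold Rdiv. rewrite Rmult_assoc, Rinv_l, Rmult_1_r by nra.
    eapply Rle_lt_trans; [apply Cexp_taylor_3|].
    assert (He1 : exp (Cmod w) <= exp 1) by (apply exp_le_compat; lra).
    assert (Cmod w < eps / A) by lra.
    assert (Cmod w * A < eps).
    { apply Rmult_lt_compat_r with (r := A) in H; [|easy].
      replace (eps / A * A) with eps in H by (field; lra). exact H. }
    assert (0 < Cmod w * Cmod w) by nra.
    apply Rle_lt_trans with (Cmod w * A * (Cmod w * Cmod w)); [|nra].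
    unfold A. assert (0 < Cmod w * Cmod w * Cmod w) by nra. nra.
  - intros w _. rewrite expq_0.
    destruct (excluded_middle_informative (w = 0)) as [->|Hn].
    + rewrite expq_0. ring.
    + field. exact Hn.
Qed.

(** The functional equation moves the question to 0, where the quotient is [expq]. *)
Lemma holo_Cexp (z : C) : holo Cexp z.
Proof.
  exists 1, (fun w => Cexp z * expq (w - z))%C. split; [lra|]. split.
  - apply contC_mult; [apply contC_const|].
    apply (contC_comp expq (fun w => w - z)%C); [apply holo_contC; holo_auto|].
    replace (z - z)%C with (RtoC 0) by ring. apply holo_contC, holo_expq_0.
  - intros w _. replace (Cexp w) with (Cexp z * Cexp (w - z))%C.
    + rewrite (expq_spec (w - z)). ring.
    + rewrite <- Cexp_plus. f_equal. ring.
Qed.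

Lemma holo_expq (z : C) : holo expq z.
Proof.
  destruct (excluded_middle_informative (z = 0)) as [->|H]; [apply holo_expq_0|].
  apply holo_local with (fun w => (Cexp w - 1) / w)%C (Cmod z); [now apply Cmod_gt_0| |].
  - intros w Hw. unfold expq. destruct (excluded_middle_informative (w = 0)) as [->|]; [|easy].
    rewrite Cmod_minus_sym in Hw. replace (z - 0)%C with z in Hw by ring. lra.
  - apply holo_div; [apply holo_minus; [apply holo_Cexp|apply holo_const]|apply holo_id|easy].
Qed.

(** * Binomial remainders *)

Definition xpow (e : C) (x : R) : C := Cexp (e * ln (1 + x)).

Lemma ln_1p_bounds (x : R) : 0 <= x -> 0 <= ln (1 + x) <= x.
Proof.
  intros Hx. split.
  - rewrite <- ln_1. apply ln_le; lra.
  - rewrite <- (ln_exp x) at 2. apply ln_le; [lra|]. apply exp_ineq1_le.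
Qed.

(** Since ln (1+x) lies in [0,1], exponents at distance less than 1 from e0 give powers bounded by
    exp(|e0| + 1); the factor 2 is that of [Cexp_minus_1_bound]. *)
Lemma lip_at_xpow (e0 : C) (x : R) : 0 <= x <= 1 ->
  lip_at (fun e => xpow e x) e0 1 (2 * exp (Cmod e0 + 1)).
Proof.
  intros Hx e He. unfold xpow. set (l := ln (1 + x)).
  assert (Hl : 0 <= l <= 1) by (assert (h := ln_1p_bounds x ltac:(lra)); fold l in h; lra).
  assert (Hb : forall u : C, Cmod (u * l) <= Cmod u).
  { intros u. rewrite Cmod_mult, Cmod_R, Rabs_pos_eq by lra. assert (h := Cmod_ge_0 u). nra. }
  assert (P := exp_pos (Cmod e0 + 1)). split.
  - apply Rle_trans with (exp (Cmod e0 + 1)); [|lra].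
    eapply Rle_trans; [apply Cmod_Cexp_le|]. apply exp_le_compat.
    assert (h := Hb e). assert (h2 := Cmod_minus_ge e e0). lra.
  - replace (Cexp (e * l) - Cexp (e0 * l))%C with (Cexp (e0 * l) * (Cexp ((e - e0) * l) - 1))%C.
    2:{ replace (e * l)%C with (e0 * l + (e - e0) * l)%C by ring. rewrite Cexp_plus. ring. }
    rewrite Cmod_mult, exp_plus.
    assert (h1 := Cmod_Cexp_le (e0 * l)). assert (h2 := exp_le_compat _ _ (Hb e0)).
    assert (h3 := Cexp_minus_1_bound ((e - e0) * l)%C).
    assert (h4 : exp (Cmod ((e - e0) * l)) <= exp 1) by (apply exp_le_compat; assert (h := Hb (e - e0)%C); lra).
    assert (h5 := Hb (e - e0)%C). assert (h6 := Cmod_ge_0 ((e - e0) * l)%C).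
    assert (h7 := exp_pos (Cmod ((e - e0) * l))).
    assert (Cmod ((e - e0) * l) * exp (Cmod ((e - e0) * l)) <= Cmod (e - e0) * exp 1)
      by (apply Rmult_le_compat; lra).
    apply Rle_trans with (exp (Cmod e0) * (2 * (Cmod (e - e0) * exp 1))); [|right; ring].
    apply Rmult_le_compat; try apply Cmod_ge_0; lra.
Qed.

(* ((1+x)^e - 1) / e, with its limit ln (1+x) at e = 0. *)
Definition binom_rem_zero (e : C) (x : R) : C := (ln (1 + x) * expq (e * ln (1 + x)))%C.

Lemma binom_rem_zero_spec (e : C) (x : R) : (e * binom_rem_zero e x)%C = (xpow e x - 1)%C.
Proof. unfold binom_rem_zero, xpow. rewrite expq_spec. ring. Qed.

(** The division by e cancels the factor e of the chain rule, so the formula includes e = 0, where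
    it differentiates ln (1+x). *)
Lemma derivC_binom_rem_zero (e : C) (x : R) : 0 <= x -> derivC (binom_rem_zero e) x (xpow (e - 1) x).
Proof.
  intros Hx.
  assert (Hl : is_derive (fun y => ln (1 + y)) x (/ (1 + x))).
  { auto_derive; [lra|]. field. lra. }
  assert (Hm : xpow (e - 1) x = (xpow e x * RtoC (/ (1 + x)))%C).
  { unfold xpow. replace ((e - 1) * ln (1 + x))%C with (e * ln (1 + x) + RtoC (- ln (1 + x)))%C.
    - rewrite Cexp_plus, Cexp_RtoC, exp_Ropp, exp_ln by lra. reflexivity.
    - rewrite RtoC_opp. ring. }
  rewrite Hm.
  destruct (excluded_middle_informative (e = 0)) as [->|He].
  - apply derivC_ext with (fun y => RtoC (ln (1 + y))).
    + intros y. unfold binom_rem_zero. rewrite Cmult_0_l, expq_0. ring.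
    + replace (xpow 0 x) with (RtoC 1) by (unfold xpow; now rewrite Cmult_0_l, Cexp_0).
      rewrite Cmult_1_l. now apply derivC_RtoC.
  - apply derivC_ext with (fun y => / e * (Cexp (e * ln (1 + y)) - 1))%C.
    + intros y. fold (xpow e y). rewrite <- binom_rem_zero_spec. field. exact He.
    + replace (xpow e x * RtoC (/ (1 + x)))%C
        with (/ e * (e * RtoC (/ (1 + x)) * Cexp (e * ln (1 + x)) - 0))%C
        by (unfold xpow; field; exact He).
      apply derivC_scal, derivC_minus; [|apply derivC_const].
      now apply (derivC_Cexp e (fun y => ln (1 + y))).
Qed.

(* binom(e, j+1) / e *)
Fixpoint binom_div (j : nat) (e : C) : C :=
  match j with
  | O => 1
  | S i => (binom_div i e * (e - INR (S i)) / INR (S (S i)))%C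
  end.

Lemma RtoC_INR_S_neq_0 (n : nat) : RtoC (INR (S n)) <> 0.
Proof. intros H. apply RtoC_inj in H. revert H. apply not_0_INR. lia. Qed.

Lemma RtoC_INR_S (n : nat) : RtoC (INR (S n)) = (RtoC (INR n) + 1)%C.
Proof. rewrite S_INR. apply RtoC_plus. Qed.

(** The absorption identity (j+2) binom(e, j+2) = e binom(e-1, j+1), divided by e. *)
Lemma binom_div_shift (j : nat) (e : C) :
  (INR (S (S j)) * binom_div (S j) e = (e - 1) * binom_div j (e - 1))%C.
Proof.
  induction j as [|j IH].
  - change (INR 2 * (1 * (e - 1) / INR 2) = (e - 1) * 1)%C.
    assert (h := RtoC_INR_S_neq_0 1). field. exact h.
  - change (binom_div (S (S j)) e) with (binom_div (S j) e * (e - INR (S (S j))) / INR (S (S (S j))))%C.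
    change (binom_div (S j) (e - 1)%C) with (binom_div j (e - 1) * (e - 1 - INR (S j)) / INR (S (S j)))%C.
    assert (h1 := RtoC_INR_S_neq_0 (S j)). assert (h2 := RtoC_INR_S_neq_0 (S (S j))).
    transitivity ((INR (S (S j)) * binom_div (S j) e) * (e - INR (S (S j))) / INR (S (S j)))%C.
    + field. now split.
    + rewrite IH. rewrite (RtoC_INR_S (S j)) at 1. field. exact h1.
Qed.

Lemma holo_binom_div (j : nat) (e : C) : holo (binom_div j) e.
Proof.
  induction j as [|j IH]; [apply holo_const|].
  change (holo (fun w => binom_div j w * (w - INR (S j)) / INR (S (S j)))%C e).
  apply holo_div; [| apply holo_const | apply RtoC_INR_S_neq_0].
  apply holo_mult; [exact IH|]. apply holo_minus; [apply holo_id|apply holo_const].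
Qed.

(* The remainder of order m + 1 in the expansion of ((1+x)^e - 1) / e in powers of x. *)
Fixpoint binom_rem (m : nat) (e : C) (x : R) : C :=
  match m with
  | O => binom_rem_zero e x
  | S i => (binom_rem i e x - binom_div i e * RtoC (x ^ S i))%C
  end.

(** Differentiating the expansion of (1+x)^e gives e times that of (1+x)^(e-1), and absorption
    matches the coefficients. The order drops by one, which opens an induction. *)
Lemma derivC_binom_rem (m : nat) (e : C) (x : R) : 0 <= x ->
  derivC (binom_rem (S m) e) x ((e - 1) * binom_rem m (e - 1) x)%C.
Proof.
  intros Hx. induction m as [|m IH].
  - change (binom_rem 0 (e - 1) x) with (binom_rem_zero (e - 1) x). rewrite binom_rem_zero_spec.
    replace (xpow (e - 1) x - 1)%C with (xpow (e - 1) x - binom_div 0 e * 1)%C by (simpl; ring).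
    apply (derivC_minus (binom_rem_zero e) (fun y => binom_div 0 e * RtoC (y ^ 1))%C); [now apply derivC_binom_rem_zero|].
    apply derivC_scal, (derivC_RtoC (fun y => y ^ 1)). auto_derive; [easy|ring].
  - replace ((e - 1) * binom_rem (S m) (e - 1) x)%C
      with ((e - 1) * binom_rem m (e - 1) x - binom_div (S m) e * RtoC (INR (S (S m)) * x ^ S m))%C.
    + apply (derivC_minus (binom_rem (S m) e) (fun y => binom_div (S m) e * RtoC (y ^ S (S m)))%C); [exact IH|].
      apply derivC_scal, (derivC_RtoC (fun y => y ^ S (S m))).
      apply is_derive_Reals, (derivable_pt_lim_pow x (S (S m))).
    + change (binom_rem (S m) (e - 1) x) with (binom_rem m (e - 1) x - binom_div m (e - 1) * RtoC (x ^ S m))%C.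
      rewrite RtoC_mult.
      transitivity ((e - 1) * binom_rem m (e - 1) x - (INR (S (S m)) * binom_div (S m) e) * RtoC (x ^ S m))%C; [ring|].
      rewrite binom_div_shift. ring.
Qed.

Lemma binom_rem_0 (m : nat) (e : C) : binom_rem m e 0 = 0.
Proof.
  induction m as [|m IH].
  - simpl. unfold binom_rem_zero. rewrite Rplus_0_r, ln_1. ring.
  - change (binom_rem m e 0 - binom_div m e * RtoC (0 ^ S m) = 0)%C. rewrite IH, pow_i by lia. ring.
Qed.

Lemma holo_binom_rem (m : nat) (e : C) (x : R) : holo (fun w => binom_rem m w x) e.
Proof.
  induction m as [|m IH].
  - simpl. unfold binom_rem_zero. apply holo_mult; [apply holo_const|].
    apply (holo_comp expq (fun w => w * ln (1 + x))%C); [holo_auto|apply holo_expq].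
  - change (holo (fun w => binom_rem m w x - binom_div m w * RtoC (x ^ S m))%C e).
    apply holo_minus; [exact IH|]. apply holo_mult; [apply holo_binom_div|apply holo_const].
Qed.

(** Each order integrates the preceding one at e - 1 and so gains a power of x. That B does not
    depend on x is what permits summation over x = 1/n. *)
Lemma lip_at_binom_rem (m : nat) : forall e0 : C, exists B, 0 <= B /\
  forall x, 0 <= x <= 1 -> lip_at (fun e => binom_rem m e x) e0 1 (B * x ^ S m).
Proof.
  assert (Sh : forall (f : C -> C) (e0 : C) (B : R), lip_at f (e0 - 1)%C 1 B ->
      lip_at (fun e => f (e - 1)%C) e0 1 B).
  { intros f e0 B. apply (lip_at_isometry f (fun e => e - 1)%C). intros w. f_equal. ring. }
  induction m as [|m IH]; intros e0.
  - set (B := 2 * exp (Cmod (e0 - 1) + 1)).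
    assert (0 < B) by (unfold B; assert (h := exp_pos (Cmod (e0 - 1) + 1)); lra).
    exists (2 * B). split; [lra|]. intros x Hx. rewrite pow_1.
    apply (lip_at_mean_value binom_rem_zero (fun e y => xpow (e - 1) y)); try lra.
    + intros e. apply (binom_rem_0 0).
    + intros e y Hy. apply derivC_binom_rem_zero. lra.
    + intros y Hy. apply (Sh (fun e => xpow e y)). apply lip_at_xpow. lra.
  - destruct (IH (e0 - 1)%C) as [B [HB K]].
    (* On the unit disc around e0, A bounds |e - 1|; being at least 1, it also bounds the difference
       quotient of e - 1. *)
    set (A := Cmod e0 + 2). assert (HA : 0 < A) by (unfold A; assert (h := Cmod_ge_0 e0); lra).
    exists (2 * (2 * A * B)). split; [nra|]. intros x Hx.
    assert (HAB : 0 <= 2 * A * B) by nra.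
    replace (2 * (2 * A * B) * x ^ S (S m)) with (2 * (2 * A * (B * x ^ S m)) * x) by (simpl; ring).
    apply (lip_at_mean_value (binom_rem (S m)) (fun e y => (e - 1) * binom_rem m (e - 1) y)%C); try lra.
    + intros e. apply binom_rem_0.
    + intros e y Hy. apply derivC_binom_rem. lra.
    + intros y Hy. apply (lip_at_mult (fun e => e - 1)%C (fun e => binom_rem m (e - 1) y)); [lra| |].
      * intros e He. unfold A. assert (h0 := Cmod_ge_0 (e - e0)).
        replace ((e - 1) - (e0 - 1))%C with (e - e0)%C by ring.
        split.
        -- assert (h1 := Cmod_minus_le e 1). assert (h2 := Cmod_minus_ge e e0).
           rewrite Cmod_1 in h1. lra.
        -- assert (h := Cmod_ge_0 e0). nra.
      * apply (Sh (fun e => binom_rem m e y)). intros e He.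
        destruct (K y ltac:(lra) e He) as [k1 k2].
        (* The bound at y is relaxed to the endpoint x, since the mean value lemma wants one
           constant on [0,x]. *)
        assert (P : B * y ^ S m <= B * x ^ S m).
        { apply Rmult_le_compat_l; [easy|]. apply pow_incr. lra. }
        split; [lra|]. eapply Rle_trans; [apply k2|].
        apply Rmult_le_compat_r; [apply Cmod_ge_0|easy].
Qed.

(** * Powers of integers *)

Lemma INR_S_ge_1 (k : nat) : 1 <= INR (S k).
Proof. rewrite S_INR. assert (h := pos_INR k). lra. Qed.

Lemma Rpower_pos (x y : R) : 0 < Rpower x y.
Proof. apply exp_pos. Qed.

Lemma is_lim_seq_Rpower_neg (b : R) : 0 < b ->
  is_lim_seq (fun k => Rpower (INR (S k)) (- b)) 0.
Proof.
  intros Hb. apply is_lim_seq_spec. intros eps.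
  (* The solution of y^(-b) = eps. *)
  assert (He := cond_pos eps). set (y := Rpower eps (- / b)).
  destruct (INR_unbounded y) as [N HN]. exists N. intros n Hn.
  assert (Hy : 0 < y) by apply Rpower_pos.
  assert (Hny : y < INR (S n)).
  { eapply Rlt_trans; [apply HN|]. apply lt_INR. lia. }
  rewrite Rminus_0_r, Rabs_pos_eq by (left; apply Rpower_pos).
  assert (h := Rlt_Rpower_l _ _ b Hb (conj Hy Hny)).
  unfold y in h. rewrite Rpower_mult in h. replace (- / b * b) with (- (1)) in h by (field; lra).
  rewrite Rpower_Ropp, Rpower_1 in h by easy. rewrite Rpower_Ropp.
  rewrite <- (Rinv_inv eps). apply Rinv_lt_contravar; [|exact h].
  apply Rmult_lt_0_compat; [now apply Rinv_0_lt_compat|apply Rpower_pos].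
Qed.

(** A discrete integral test. With m = n + 1, n^(-b) = m^(-b) exp(b ln(m/n)); then exp y >= 1 + y
    and ln(m/n) >= 1/m suffice. The right-hand side telescopes. *)
Lemma Rpower_diff_ge (b : R) (k : nat) : 0 < b ->
  b * Rpower (INR (S (S k))) (- (b + 1)) <= Rpower (INR (S k)) (- b) - Rpower (INR (S (S k))) (- b).
Proof.
  intros Hb. assert (H1 := INR_S_ge_1 k). assert (H2 := INR_S_ge_1 (S k)).
  set (n := INR (S k)) in *. set (m := INR (S (S k))) in *.
  assert (Em : m = n + 1) by apply S_INR.
  replace (- (b + 1)) with (- b + - (1)) by ring.
  rewrite Rpower_plus, (Rpower_Ropp m 1), (Rpower_1 m) by lra.
  assert (E : Rpower n (- b) = Rpower m (- b) * exp (b * (ln m - ln n))).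
  { unfold Rpower. rewrite <- exp_plus. f_equal. ring. }
  rewrite E. assert (P := Rpower_pos m (- b)).
  assert (h1 := exp_ineq1_le (b * (ln m - ln n))).
  assert (h2 : / m <= ln m - ln n).
  { assert (h : ln (n / m) <= - / m).
    { rewrite <- (ln_exp (- / m)). apply ln_le; [apply Rdiv_lt_0_compat; lra|].
      assert (h := exp_ineq1_le (- / m)). replace (n / m) with (1 + - / m); [easy|].
      rewrite Em. field. lra. }
    rewrite ln_div in h by lra. lra. }
  assert (b * / m <= b * (ln m - ln n)) by (apply Rmult_le_compat_l; lra).
  nra.
Qed.

Lemma ex_series_Rpower (a : R) : 1 < a -> ex_series (fun k => Rpower (INR (S k)) (- a)).
Proof.
  intros Ha. apply ex_series_incr_1. set (b := a - 1). assert (Hb : 0 < b) by (unfold b; lra).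
  set (u := fun k => Rpower (INR (S k)) (- b)).
  apply (ex_series_le (fun k => Rpower (INR (S (S k))) (- a)) (fun k => / b * (u k - u (S k)))).
  - intros k. change (Rabs (Rpower (INR (S (S k))) (- a)) <= / b * (u k - u (S k))).
    rewrite Rabs_pos_eq by (left; apply Rpower_pos).
    apply Rmult_le_reg_l with b; [easy|]. rewrite <- Rmult_assoc, Rinv_r, Rmult_1_l by lra.
    replace (- a) with (- (b + 1)) by (unfold b; ring). now apply Rpower_diff_ge.
  - apply (ex_series_scal_l (/ b) (fun k => u k - u (S k))). exists (u 0%nat).
    change (is_lim_seq (sum_n (fun k => u k - u (S k))) (u 0%nat)).
    apply is_lim_seq_ext with (fun n => u 0%nat - u (S n)).
    + intros n. induction n as [|n IH]; [now rewrite sum_O|].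
      rewrite sum_Sn, <- IH. unfold plus; simpl. ring.
    + replace (Finite (u 0%nat)) with (Finite (u 0%nat - 0)) by (f_equal; ring).
      apply is_lim_seq_minus'; [apply is_lim_seq_const|].
      apply (is_lim_seq_incr_1 u). now apply is_lim_seq_Rpower_neg.
Qed.

Lemma Cnpow_plus (n : nat) (s t : C) : Cnpow n (s + t) = (Cnpow n s * Cnpow n t)%C.
Proof. unfold Cnpow. rewrite <- Cexp_plus. f_equal. ring. Qed.

Lemma Cmod_Cnpow (n : nat) (s : C) : Cmod (Cnpow n s) = Rpower (INR n) (Re s).
Proof.
  unfold Cnpow. rewrite Cmod_Cexp. unfold Rpower. f_equal.
  unfold Re, Cmult, RtoC; simpl. ring.
Qed.

Lemma Cnpow_opp_INR (n m : nat) : Cnpow (S n) (- INR m) = RtoC ((/ INR (S n)) ^ m).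
Proof.
  assert (H := INR_S_ge_1 n). unfold Cnpow.
  rewrite <- RtoC_opp, <- RtoC_mult, Cexp_RtoC. f_equal.
  change (Rpower (INR (S n)) (- INR m) = (/ INR (S n)) ^ m).
  rewrite Rpower_Ropp, Rpower_pow, pow_inv by lra. reflexivity.
Qed.

Lemma pow_inv_Rpower (n m : nat) : (/ INR (S n)) ^ m = Rpower (INR (S n)) (- INR m).
Proof. assert (H := INR_S_ge_1 n). rewrite Rpower_Ropp, Rpower_pow, pow_inv by lra. reflexivity. Qed.

Lemma holo_Cnpow (n : nat) (s : C) : holo (Cnpow n) s.
Proof. unfold Cnpow. apply (holo_comp Cexp (fun s => s * ln (INR n))%C); [holo_auto|apply holo_Cexp]. Qed.

(** One eps in the exponent pays for moving s within the disc. The other absorbs the factor ln n of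
    the difference quotient, through ln n <= n^eps / eps. *)
Lemma lip_at_Cnpow (s0 : C) (eps : R) (k : nat) : 0 < eps <= 1 ->
  lip_at (Cnpow (S k)) s0 eps (2 / eps * Rpower (INR (S k)) (Re s0 + 2 * eps)).
Proof.
  intros He s Hs. unfold Rpower. set (l := ln (INR (S k))).
  assert (Hl : 0 <= l) by (unfold l; rewrite <- ln_1; apply ln_le; [lra|apply INR_S_ge_1]).
  assert (H2 : 2 <= 2 / eps).
  { unfold Rdiv. assert (1 <= / eps) by (rewrite <- Rinv_1; apply Rinv_le_contravar; lra). lra. }
  assert (P := exp_pos ((Re s0 + 2 * eps) * l)).
  split.
  - rewrite Cmod_Cnpow. unfold Rpower. fold l.
    apply Rle_trans with (exp ((Re s0 + 2 * eps) * l)); [|nra].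
    apply exp_le_compat. apply Rmult_le_compat_r; [easy|].
    assert (h := re_le_Cmod (s - s0)%C). assert (h' := Rle_abs (Re (s - s0)%C)).
    change (Re (s - s0)%C) with (Re s - Re s0) in *. lra.
  - replace (Cnpow (S k) s - Cnpow (S k) s0)%C with (Cnpow (S k) s0 * (Cexp ((s - s0) * l) - 1))%C.
    2:{ replace (Cnpow (S k) s) with (Cnpow (S k) (s0 + (s - s0))) by (f_equal; ring).
        rewrite Cnpow_plus. unfold Cnpow. fold l. ring. }
    rewrite Cmod_mult, Cmod_Cnpow. unfold Rpower. fold l.
    assert (h1 := Cexp_minus_1_bound ((s - s0) * l)%C).
    rewrite Cmod_mult, Cmod_R, (Rabs_pos_eq l Hl) in h1.
    set (d := Cmod (s - s0)) in *. assert (Hd : 0 <= d) by apply Cmod_ge_0.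
    assert (h2 : exp (d * l) <= exp (eps * l)) by (apply exp_le_compat; nra).
    assert (h3 : l <= / eps * exp (eps * l)).
    { assert (h := exp_ineq1_le (eps * l)). apply Rmult_le_reg_l with eps; [lra|].
      rewrite <- Rmult_assoc, Rinv_r, Rmult_1_l by lra. lra. }
    assert (Q := exp_pos (eps * l)). assert (Q' := exp_pos (d * l)).
    assert (h4 : l * exp (d * l) <= / eps * exp (eps * l) * exp (eps * l))
      by (apply Rmult_le_compat; lra).
    assert (h5 : Cmod (Cexp ((s - s0) * l) - 1) <= 2 * (d * (/ eps * exp (eps * l) * exp (eps * l)))).
    { eapply Rle_trans; [apply h1|]. apply Rmult_le_compat_l; [lra|]. rewrite Rmult_assoc.
      apply Rmult_le_compat_l; lra. }
    eapply Rle_trans; [apply Rmult_le_compat_l; [left; apply exp_pos|apply h5]|].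
    right. replace ((Re s0 + 2 * eps) * l) with (Re s0 * l + eps * l + eps * l) by ring.
    rewrite !exp_plus. field. lra.
Qed.

(** * The zeta function *)

Definition zeta (s : C) : C := CSeries (fun k => Cnpow (S k) (- s)).

Lemma summable_zeta (s : C) : 1 < Re s -> summable (fun k => Cnpow (S k) (- s)).
Proof.
  intros Hs. apply summable_le with (fun k => Rpower (INR (S k)) (- Re s)).
  - intros k. rewrite Cmod_Cnpow. right. reflexivity.
  - now apply ex_series_Rpower.
Qed.

(** With n = k + 1: what remains of ((n+1)^(1-s) - n^(1-s))/(1-s) after the first m terms of its
    expansion in 1/n. *)
Definition binom_rem_term (m : nat) (s : C) (k : nat) : C :=
  (Cnpow (S k) (1 - s) * binom_rem m (1 - s) (/ INR (S k)))%C.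

Definition binom_rem_series (m : nat) (s : C) : C := CSeries (binom_rem_term m s).

(** The term has size n^(1 - Re s) n^(-(m+1)), which explains the half-plane. *)
Lemma binom_rem_term_bound (m : nat) (s0 : C) : 1 - INR m < Re s0 ->
  exists eps M, 0 < eps /\ ex_series M /\
    forall k, lip_at (fun s => binom_rem_term m s k) s0 eps (M k).
Proof.
  intros Hs. set (d := Re s0 + INR m - 1). assert (Hd : 0 < d) by (unfold d; lra).
  (* With a third of the margin d, the loss of 2 eps in [lip_at_Cnpow] still leaves an exponent 1 +
     d - 2 eps above 1. *)
  set (eps := Rmin 1 (d / 3)).
  assert (He : 0 < eps) by (apply Rmin_pos; lra).
  assert (He1 : eps <= 1) by apply Rmin_l. assert (He2 : eps <= d / 3) by apply Rmin_r.
  destruct (lip_at_binom_rem m (1 - s0)%C) as [B [HB K]].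
  exists eps, (fun k => 2 * (2 / eps) * B * Rpower (INR (S k)) (- (1 + d - 2 * eps))).
  split; [easy|]. split.
  - apply (ex_series_scal_l (2 * (2 / eps) * B) (fun k => Rpower (INR (S k)) (- (1 + d - 2 * eps)))).
    apply ex_series_Rpower. lra.
  - intros k.
    assert (I : forall w, Cmod ((1 - w) - (1 - s0)) = Cmod (w - s0)).
    { intros w. rewrite Cmod_minus_sym. f_equal. ring. }
    assert (X : 0 <= / INR (S k) <= 1).
    { assert (h := INR_S_ge_1 k). split; [left; apply Rinv_0_lt_compat; lra|].
      rewrite <- Rinv_1. apply Rinv_le_contravar; lra. }
    assert (L1 := lip_at_isometry _ (fun s => 1 - s)%C s0 _ _ I (lip_at_Cnpow (1 - s0)%C eps k (conj He He1))).
    assert (L2 := lip_at_weaken _ _ _ eps _ He1 (lip_at_isometry _ (fun s => 1 - s)%C s0 _ _ I (K _ X))).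
    assert (L3 := lip_at_mult _ _ _ _ _ _ He L1 L2).
    replace (2 * (2 / eps) * B * Rpower (INR (S k)) (- (1 + d - 2 * eps)))
      with (2 * (2 / eps * Rpower (INR (S k)) (Re (1 - s0)%C + 2 * eps)) * (B * (/ INR (S k)) ^ S m)).
    + exact L3.
    + rewrite pow_inv_Rpower.
      replace (- (1 + d - 2 * eps)) with ((Re (1 - s0)%C + 2 * eps) + - INR (S m)).
      * rewrite (Rpower_plus _ (- INR (S m))). ring.
      * rewrite S_INR. unfold d. change (Re (1 - s0)%C) with (1 - Re s0). ring.
Qed.

Lemma holo_binom_rem_series (m : nat) (s : C) : 1 - INR m < Re s -> holo (binom_rem_series m) s.
Proof.
  intros Hs. destruct (binom_rem_term_bound m s Hs) as [eps [M [He [HM HL]]]].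
  apply (holo_CSeries (fun k s => binom_rem_term m s k) M s eps 0); auto.
  intros k. unfold binom_rem_term. apply holo_mult.
  - apply (holo_comp (Cnpow (S k)) (fun s => 1 - s)%C); [holo_auto|apply holo_Cnpow].
  - apply (holo_comp (fun e => binom_rem m e (/ INR (S k))) (fun s => 1 - s)%C); [holo_auto|apply holo_binom_rem].
Qed.

Lemma summable_binom_rem_term (m : nat) (s : C) : 1 - INR m < Re s -> summable (binom_rem_term m s).
Proof.
  intros Hs. destruct (binom_rem_term_bound m s Hs) as [eps [M [He [HM HL]]]].
  apply summable_le with M; [|easy]. intros k. apply (HL k). rewrite Cmod_self. lra.
Qed.

Lemma binom_rem_term_S (m : nat) (s : C) (k : nat) :
  binom_rem_term (S m) s k = (binom_rem_term m s k - binom_div m (1 - s) * Cnpow (S k) (- (s + INR m)))%C.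
Proof.
  unfold binom_rem_term. change (binom_rem (S m) (1 - s) (/ INR (S k)))
    with (binom_rem m (1 - s) (/ INR (S k)) - binom_div m (1 - s) * RtoC ((/ INR (S k)) ^ S m))%C.
  rewrite <- Cnpow_opp_INR.
  replace (Cnpow (S k) (- (s + INR m))) with (Cnpow (S k) (1 - s) * Cnpow (S k) (- INR (S m)))%C.
  - ring.
  - rewrite <- Cnpow_plus. f_equal. rewrite RtoC_INR_S. ring.
Qed.

Lemma binom_rem_term_0 (s : C) (k : nat) :
  ((1 - s) * binom_rem_term 0 s k = Cnpow (S (S k)) (1 - s) - Cnpow (S k) (1 - s))%C.
Proof.
  assert (H := INR_S_ge_1 k).
  replace (Cnpow (S (S k)) (1 - s)) with (Cnpow (S k) (1 - s) * xpow (1 - s) (/ INR (S k)))%C.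
  - unfold binom_rem_term. change (binom_rem 0 (1 - s) (/ INR (S k))) with (binom_rem_zero (1 - s) (/ INR (S k))).
    replace ((1 - s) * (Cnpow (S k) (1 - s) * binom_rem_zero (1 - s) (/ INR (S k))))%C
      with (Cnpow (S k) (1 - s) * ((1 - s) * binom_rem_zero (1 - s) (/ INR (S k))))%C by ring.
    rewrite binom_rem_zero_spec. ring.
  - unfold Cnpow, xpow. rewrite <- Cexp_plus. f_equal.
    rewrite <- Cmult_plus_distr_l, <- RtoC_plus, <- ln_mult.
    + do 3 f_equal. rewrite (S_INR (S k)). field. lra.
    + lra.
    + assert (0 < / INR (S k)) by (apply Rinv_0_lt_compat; lra). lra.
Qed.

(* Summing (n+1)^(1-s) - n^(1-s) telescopes to -1. *)
Lemma zeta_binom_rem_series_1 (s : C) : 1 < Re s -> zeta s = (/ (s - 1) - binom_rem_series 1 s)%C.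
Proof.
  intros Hs.
  assert (Hn : (1 - s)%C <> 0).
  { intros H. assert (h := f_equal Re H). change (1 - Re s = 0) in h. lra. }
  assert (Hn' : (s - 1)%C <> 0).
  { intros H. assert (h := f_equal Re H). change (Re s - 1 = 0) in h. lra. }
  assert (Z := summable_zeta s Hs).
  assert (S0 : summable (binom_rem_term 1 s)) by (apply summable_binom_rem_term; simpl; lra).
  set (u := fun k => Cnpow (S k) (1 - s)).
  assert (T : CSeries (fun k => u (S k) - u k)%C = (- u 0%nat)%C).
  { apply CSeries_telescope.
    apply is_lim_seq_ext with (fun k => Rpower (INR (S k)) (- (Re s - 1))).
    - intros k. unfold u. rewrite Cmod_Cnpow. f_equal. change (Re (1 - s)%C) with (1 - Re s). ring.
    - apply is_lim_seq_Rpower_neg. lra. }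
  assert (U0 : u 0%nat = 1).
  { unfold u, Cnpow. simpl INR. rewrite ln_1, Cmult_0_r. apply Cexp_0. }
  rewrite U0 in T.
  rewrite (CSeries_ext _ (fun k => (1 - s) * (binom_rem_term 1 s k + Cnpow (S k) (- s)))%C) in T.
  - rewrite CSeries_scal, CSeries_plus in T by auto using summable_plus.
    fold (zeta s) in T. fold (binom_rem_series 1 s) in T.
    replace (zeta s) with (((1 - s) * (binom_rem_series 1 s + zeta s)) / (1 - s) - binom_rem_series 1 s)%C by (field; exact Hn).
    rewrite T. field. now split.
  - intros k. unfold u. rewrite <- binom_rem_term_0, binom_rem_term_S. simpl binom_div.
    replace (s + INR 0)%C with s by (simpl; ring). ring.
Qed.

Lemma binom_rem_series_diff (m : nat) (s : C) : 1 - INR m < Re s ->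
  binom_rem_series (S m) s = (binom_rem_series m s - binom_div m (1 - s) * zeta (s + INR m))%C.
Proof.
  intros Hs. unfold binom_rem_series.
  assert (Z : summable (fun k => Cnpow (S k) (- (s + INR m)))).
  { apply summable_zeta. change (Re (s + INR m)%C) with (Re s + INR m). lra. }
  rewrite (CSeries_ext _ _ (binom_rem_term_S m s)), CSeries_minus, CSeries_scal; auto using summable_scal.
  now apply summable_binom_rem_term.
Qed.

(* [zeta_reg_upto p] continues zeta(s) - 1/(s-1) to the half-plane Re s > -p. *)
Fixpoint zeta_reg_upto (p : nat) (s : C) : C :=
  match p with
  | O => (- binom_rem_series 1 s)%C
  | S q =>
      (Csum (fun j => binom_div j (1 - s) / INR (S (S j)) - binom_div (S j) (1 - s) * zeta_reg_upto q (s + INR (S j))) (S q)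
       - binom_rem_series (S (S q)) s)%C
  end.

Lemma zeta_reg_upto_S (q : nat) (s : C) : zeta_reg_upto (S q) s =
  (Csum (fun j => binom_div j (1 - s) / INR (S (S j)) - binom_div (S j) (1 - s) * zeta_reg_upto q (s + INR (S j))) (S q)
       - binom_rem_series (S (S q)) s)%C.
Proof. reflexivity. Qed.

Lemma holo_zeta_reg_upto (p : nat) : forall s, - INR p < Re s -> holo (zeta_reg_upto p) s.
Proof.
  induction p as [|p IH]; intros s Hs.
  - apply holo_ext with (fun s => - (1) * binom_rem_series 1 s)%C; [intros w; simpl; ring|].
    apply holo_mult; [apply holo_const|]. apply holo_binom_rem_series. simpl in *. lra.
  - apply holo_ext with (1 := zeta_reg_upto_S p). apply holo_minus.
    + apply (holo_Csum (fun j s => binom_div j (1 - s) / INR (S (S j)) - binom_div (S j) (1 - s) * zeta_reg_upto p (s + INR (S j)))%C).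
      intros j Hj.
      assert (Hc : forall i, holo (fun w => binom_div i (1 - w)) s).
      { intros i. apply (holo_comp (binom_div i) (fun w => 1 - w)%C); [holo_auto|apply holo_binom_div]. }
      apply holo_minus.
      * apply holo_div; [apply Hc|apply holo_const|apply RtoC_INR_S_neq_0].
      * apply holo_mult; [apply Hc|].
        apply (holo_comp (zeta_reg_upto p) (fun w => w + INR (S j))%C); [holo_auto|].
        apply IH. change (Re (s + INR (S j))%C) with (Re s + INR (S j)).
        rewrite S_INR in *. assert (h := pos_INR j). lra.
    + apply holo_binom_rem_series. rewrite S_INR. lra.
Qed.

Lemma zeta_eq_zeta_reg_upto_0 (s : C) : 1 < Re s -> zeta s = (/ (s - 1) + zeta_reg_upto 0 s)%C.
Proof. intros Hs. rewrite zeta_binom_rem_series_1 by easy. simpl. ring. Qed.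

(** Explains the summand without zeta in [zeta_reg_upto]. The coefficient [binom_div (S p) (1 - s)]
    contains the factor -(s+p)/(p+2), which cancels the pole 1/(s+p) of zeta(s+p+1) and leaves
    [binom_div p (1 - s)] over p + 2. *)
Lemma zeta_reg_upto_last (p : nat) (s : C) : - INR p < Re s ->
  zeta_reg_upto p (s + INR (S p))%C = zeta_reg_upto 0 (s + INR (S p))%C ->
  (binom_div p (1 - s) / INR (S (S p)) - binom_div (S p) (1 - s) * zeta_reg_upto p (s + INR (S p)) - binom_rem_series (S (S p)) s
   = - binom_rem_series (S p) s)%C.
Proof.
  intros Hs E. rewrite binom_rem_series_diff by (rewrite S_INR; lra).
  rewrite zeta_eq_zeta_reg_upto_0.
  2:{ change (Re (s + INR (S p))%C) with (Re s + INR (S p)). rewrite S_INR. lra. }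
  rewrite E. set (v := zeta_reg_upto 0 (s + INR (S p))).
  change (binom_div (S p) (1 - s)) with (binom_div p (1 - s) * ((1 - s) - INR (S p)) / INR (S (S p)))%C.
  assert (H2 := RtoC_INR_S_neq_0 (S p)).
  assert (H3 : (s + INR (S p) - 1)%C <> 0).
  { intros H. assert (h := f_equal Re H). change (Re s + INR (S p) - 1 = 0) in h.
    rewrite S_INR in h. lra. }
  field. now split.
Qed.

(** The top summand and the new series collapse to the old series by [zeta_reg_upto_last]. The other
    summands use the preceding level at points shifted to the right, where induction applies. *)
Lemma zeta_reg_upto_step (p : nat) : forall s, - INR p < Re s -> zeta_reg_upto (S p) s = zeta_reg_upto p s.
Proof.
  induction p as [p IH] using (well_founded_induction Nat.lt_wf_0). intros s Hs.
  (* Descending from an arbitrary level to 0 uses every earlier step, hence the strong induction. *)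
  assert (D : forall q, (q <= p)%nat -> forall u, 0 < Re u -> zeta_reg_upto q u = zeta_reg_upto 0 u).
  { intros q. induction q as [|q IHq]; intros Hq u Hu; [easy|].
    rewrite IH; [apply IHq; [lia|easy]|lia|]. assert (h := pos_INR q). lra. }
  assert (L := zeta_reg_upto_last p s Hs).
  rewrite zeta_reg_upto_S. cbn [Csum].
  assert (Hu : 0 < Re (s + INR (S p))%C).
  { change (Re (s + INR (S p))%C) with (Re s + INR (S p)). rewrite S_INR. lra. }
  specialize (L (D p (le_n _) _ Hu)).
  match goal with |- (?a + ?b - ?c)%C = _ => replace (a + b - c)%C with (a + (b - c))%C by ring end.
  rewrite L. destruct p as [|q].
  - simpl. ring.
  - rewrite zeta_reg_upto_S. apply (f_equal (fun a => a + - binom_rem_series (S (S q)) s)%C). apply Csum_ext. intros j Hj. do 2 f_equal.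
    apply IH; [lia|]. change (Re (s + INR (S j))%C) with (Re s + INR (S j)).
    rewrite S_INR in *. assert (h := pos_INR j). lra.
Qed.

Lemma zeta_reg_upto_le (p q : nat) (s : C) : (p <= q)%nat -> - INR p < Re s -> zeta_reg_upto q s = zeta_reg_upto p s.
Proof.
  intros Hpq Hs. induction Hpq as [|q Hpq IH]; [easy|]. rewrite zeta_reg_upto_step; [exact IH|].
  apply le_INR in Hpq. lra.
Qed.

(** Selects a level for each point, so that the partial continuations glue to one function; their
    agreement makes the choice immaterial. *)
Lemma half_plane_index (x : R) : { p : nat | - INR p < x }.
Proof.
  apply constructive_indefinite_description. destruct (INR_unbounded (- x)) as [p Hp].
  exists p. lra.
Qed.

Definition zeta_reg (s : C) : C := zeta_reg_upto (proj1_sig (half_plane_index (Re s))) s.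

Lemma zeta_reg_eq_upto (p : nat) (s : C) : - INR p < Re s -> zeta_reg s = zeta_reg_upto p s.
Proof.
  intros Hs. unfold zeta_reg. destruct (half_plane_index (Re s)) as [q Hq]; simpl.
  destruct (Nat.le_ge_cases p q); [|symmetry]; now apply zeta_reg_upto_le.
Qed.

Lemma holo_zeta_reg (s : C) : holo zeta_reg s.
Proof.
  (* The margin 1 lets a single level serve the whole unit disc around s. *)
  destruct (half_plane_index (Re s - 1)) as [p Hp].
  apply holo_local with (zeta_reg_upto p) 1; [lra| |apply holo_zeta_reg_upto; lra].
  intros w Hw. apply zeta_reg_eq_upto. assert (h := re_le_Cmod (w - s)%C).
  change (Re (w - s)%C) with (Re w - Re s) in h.
  assert (h' := Rle_abs (- (Re w - Re s))). rewrite Rabs_Ropp in h'. lra.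
Qed.

Lemma zeta_eq_zeta_reg (s : C) : 1 < Re s -> zeta s = (/ (s - 1) + zeta_reg s)%C.
Proof. intros Hs. rewrite (zeta_reg_eq_upto 0) by (simpl; lra). now apply zeta_eq_zeta_reg_upto_0. Qed.

(** * The continuation of G *)

(** Radius and constant are uncontrolled, which is enough for factors that do not depend on the
    summation index. *)
Lemma holo_lip_at (f : C -> C) (z : C) : holo f z -> exists r M, 0 < r /\ lip_at f z r M.
Proof.
  intros Hf. assert (Hc := holo_contC _ _ Hf).
  destruct Hf as [r [phi [Hr [Hp E]]]].
  destruct (Hc 1) as [d [Hd K]]; [lra|]. destruct (Hp 1) as [d' [Hd' K']]; [lra|].
  exists (Rmin r (Rmin d d')), (Cmod (f z) + Cmod (phi z) + 1). split; [now repeat apply Rmin_pos|].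
  intros w Hw. assert (h1 := Rmin_l r (Rmin d d')). assert (h2 := Rmin_r r (Rmin d d')).
  assert (h3 := Rmin_l d d'). assert (h4 := Rmin_r d d').
  specialize (K w ltac:(lra)). specialize (K' w ltac:(lra)).
  assert (i1 := Cmod_minus_ge (f w) (f z)). assert (i2 := Cmod_minus_ge (phi w) (phi z)).
  assert (j1 := Cmod_ge_0 (f z)). assert (j2 := Cmod_ge_0 (phi z)). split; [lra|].
  rewrite E by lra. replace (f z + phi w * (w - z) - f z)%C with (phi w * (w - z))%C by ring.
  rewrite Cmod_mult. apply Rmult_le_compat_r; [apply Cmod_ge_0|]. lra.
Qed.

Definition pole_sq (k : nat) : C := RtoC (2 * PI * (INR (S k)) ^ 2).

(** Index K stands for j = K + 1 in the expansion of G. *)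
Definition zeta_arg (K : nat) (t : C) : C := (RtoC (1 / 2) + Ci * t + INR (2 * S K))%C.

(** This is (-1)^(j-1) (t/2pi)^j for j = K + 1. *)
Definition zeta_coef (K : nat) (t : C) : C := (t / (2 * PI)%R * (- t / (2 * PI)%R) ^ K)%C.

(* Defined by recursion rather than by [G_rem_term_closed], so that the step in [K] also
   holds at t = -2 pi n^2, where division by zero breaks the closed form. *)
Fixpoint G_rem_term (K : nat) (t : C) (k : nat) : C :=
  match K with
  | O => G_term t (S k)
  | S J => (G_rem_term J t k - zeta_coef J t * Cnpow (S k) (- zeta_arg J t))%C
  end.

Lemma two_pi_neq_0 : RtoC (2 * PI) <> 0.
Proof. intros H. apply RtoC_inj in H. assert (h := PI_RGT_0). lra. Qed.

(** The geometric tail: u/(1+u) minus its first K terms equals (-u)^K u/(1+u), here with u = t/(2 pi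
    n^2) cleared of inner fractions. *)
Lemma G_rem_term_closed (K : nat) (t : C) (k : nat) : (pole_sq k + t)%C <> 0 ->
  G_rem_term K t k = (Cnpow (S k) (RtoC (- (1 / 2)) - Ci * t) *
    (t * (- t / (2 * PI)%R) ^ K) * (RtoC ((/ INR (S k)) ^ (2 * K)) * / (pole_sq k + t)))%C.
Proof.
  intros Ha. assert (Hn := INR_S_ge_1 k). assert (H2 := two_pi_neq_0).
  induction K as [|K IH].
  - simpl G_rem_term. unfold G_term. fold (pole_sq k). simpl Cpow. simpl pow. field. exact Ha.
  - change (G_rem_term (S K) t k) with (G_rem_term K t k - zeta_coef K t * Cnpow (S k) (- zeta_arg K t))%C.
    rewrite IH.
    replace (Cnpow (S k) (- zeta_arg K t))
      with (Cnpow (S k) (RtoC (- (1 / 2)) - Ci * t) * Cnpow (S k) (- INR (2 * S K)))%C.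
    2:{ rewrite <- Cnpow_plus. f_equal. unfold zeta_arg. rewrite RtoC_opp. ring. }
    rewrite Cnpow_opp_INR. set (c := Cnpow (S k) _).
    replace (2 * S K)%nat with (S (S (2 * K))) by lia.
    cbn [Cpow pow]. unfold zeta_coef. rewrite !RtoC_mult, RtoC_inv by lra.
    set (y := RtoC ((/ INR (S k)) ^ (2 * K))). set (u := ((- t / (RtoC 2 * RtoC PI)) ^ K)%C).
    rewrite RtoC_mult in H2.
    assert (En : pole_sq k = (RtoC 2 * RtoC PI * (INR (S k) * INR (S k)))%C).
    { unfold pole_sq. rewrite <- !RtoC_mult. f_equal. ring. }
    rewrite En in *. assert (Hk := RtoC_INR_S_neq_0 k).
    field. repeat split; try easy; intros H; apply H2; rewrite H; ring.
Qed.

(** The closed form has size n^(-1/2 + Im t) n^(-2K-2), summable for Im t < 3/2 + 2K; d is the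
    margin. *)
Lemma G_rem_term_bound (K : nat) (t0 : C) : Im t0 < 3 / 2 + 2 * INR K ->
  exists eps M N, 0 < eps /\ ex_series M /\
    forall k, (N <= k)%nat -> lip_at (fun t => G_rem_term K t k) t0 eps (M k).
Proof.
  intros Ht. set (d := 3 / 2 + 2 * INR K - Im t0). assert (Hd : 0 < d) by (unfold d; lra).
  destruct (holo_lip_at (fun t => t * (- t / (2 * PI)%R) ^ K)%C t0) as [r [Q [Hr HQ]]].
  { apply holo_mult; [apply holo_id|]. apply holo_pow.
    apply holo_div; [|apply holo_const|apply two_pi_neq_0].
    apply holo_ext with (fun t => - (1) * t)%C; [intros; ring|holo_auto]. }
  set (eps := Rmin (Rmin 1 (d / 3)) r).
  assert (He : 0 < eps) by (repeat apply Rmin_pos; lra).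
  assert (Her : eps <= r) by apply Rmin_r.
  assert (He1 : eps <= 1) by (eapply Rle_trans; [apply Rmin_l|apply Rmin_l]).
  assert (He2 : eps <= d / 3) by (eapply Rle_trans; [apply Rmin_l|apply Rmin_r]).
  (* Once n exceeds |t0| + 1, the denominator 2 pi n^2 + t is at least n^2 in modulus on the disc,
     away from its zero. *)
  destruct (INR_unbounded (Cmod t0 + 1)) as [N HN].
  exists eps, (fun k => 2 * (2 * (2 / eps) * Q) * Rpower (INR (S k)) (- (1 + d - 2 * eps))), N.
  split; [easy|]. split.
  { apply (ex_series_scal_l (2 * (2 * (2 / eps) * Q)) (fun k => Rpower (INR (S k)) (- (1 + d - 2 * eps)))).
    apply ex_series_Rpower. lra. }
  intros k Hk. assert (Hn := INR_S_ge_1 k). set (n := INR (S k)) in *.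
  assert (HNk : Cmod t0 + 1 < n).
  { eapply Rlt_le_trans; [apply HN|]. apply le_INR. lia. }
  assert (Hlow : forall t, Cmod (t - t0) < eps -> n ^ 2 <= Cmod (pole_sq k + t)).
  { intros t Hdt. replace (pole_sq k + t)%C with (pole_sq k - - t)%C by ring.
    eapply Rle_trans; [|apply Cmod_minus_ge]. rewrite Cmod_opp. unfold pole_sq. rewrite Cmod_R. fold n.
    assert (P := PI2_1). assert (n * 1 <= n ^ 2) by (simpl; nra).
    assert (h := Cmod_minus_ge t t0).
    rewrite Rabs_pos_eq by nra. nra. }
  assert (Hne : forall t, Cmod (t - t0) < eps -> (pole_sq k + t)%C <> 0).
  { intros t Hdt. apply Cmod_gt_0. specialize (Hlow t Hdt). nra. }
  assert (L1 : lip_at (fun t => Cnpow (S k) (RtoC (- (1 / 2)) - Ci * t)) t0 eps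
            (2 / eps * Rpower n (Re (RtoC (- (1 / 2)) - Ci * t0)%C + 2 * eps))).
  { apply (lip_at_isometry (Cnpow (S k)) (fun t => RtoC (- (1 / 2)) - Ci * t)%C); [|now apply lip_at_Cnpow].
    intros w. replace (RtoC (- (1 / 2)) - Ci * w - (RtoC (- (1 / 2)) - Ci * t0))%C with (- (Ci * (w - t0)))%C by ring.
    rewrite Cmod_opp, Cmod_mult, Cmod_Ci. ring. }
  assert (L2 := lip_at_weaken _ _ _ _ _ Her HQ).
  (* The difference quotient of the inverse is a product of two inverses. One is bounded by n^(-2),
     the other merely by 1, so value and quotient share the same bound. *)
  assert (L3 : lip_at (fun t => RtoC ((/ n) ^ (2 * K)) * / (pole_sq k + t))%C t0 eps ((/ n) ^ (2 * K + 2))).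
  { intros t Hdt. assert (z0 : Cmod (t0 - t0) < eps) by (rewrite Cmod_self; lra).
    assert (P := Hlow t Hdt). assert (P0 := Hlow t0 z0).
    assert (X : 0 < (/ n) ^ (2 * K)) by (apply pow_lt, Rinv_0_lt_compat; lra).
    assert (Y : / Cmod (pole_sq k + t) <= (/ n) ^ 2).
    { rewrite pow_inv. apply Rinv_le_contravar; [|easy]. nra. }
    assert (Y0 : / Cmod (pole_sq k + t0) <= 1).
    { rewrite <- Rinv_1. apply Rinv_le_contravar; [lra|]. nra. }
    assert (W : 0 < / Cmod (pole_sq k + t)) by (apply Rinv_0_lt_compat, Cmod_gt_0; now apply Hne).
    assert (W0 : 0 < / Cmod (pole_sq k + t0)) by (apply Rinv_0_lt_compat, Cmod_gt_0; now apply Hne).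
    rewrite pow_add. split.
    - rewrite Cmod_mult, Cmod_R, Rabs_pos_eq, Cmod_inv by (try lra; now apply Hne).
      apply Rmult_le_compat_l; lra.
    - replace (RtoC ((/ n) ^ (2 * K)) * / (pole_sq k + t) - RtoC ((/ n) ^ (2 * K)) * / (pole_sq k + t0))%C
        with (RtoC ((/ n) ^ (2 * K)) * (/ (pole_sq k + t) * (/ (pole_sq k + t0) * - (t - t0))))%C
        by (field; split; now apply Hne).
      rewrite !Cmod_mult, Cmod_R, Rabs_pos_eq, !Cmod_inv, Cmod_opp by (try lra; now apply Hne).
      rewrite Rmult_assoc. apply Rmult_le_compat_l; [lra|].
      assert (D := Cmod_ge_0 (t - t0)).
      apply Rmult_le_compat; try lra; nra. }
  assert (L := lip_at_mult _ _ _ _ _ _ He (lip_at_mult _ _ _ _ _ _ He L1 L2) L3).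
  replace (2 * (2 * (2 / eps) * Q) * Rpower n (- (1 + d - 2 * eps)))
    with (2 * (2 * (2 / eps * Rpower n (Re (RtoC (- (1 / 2)) - Ci * t0)%C + 2 * eps)) * Q) * (/ n) ^ (2 * K + 2)).
  - intros t Hdt. rewrite !G_rem_term_closed by (apply Hne; try easy; rewrite Cmod_self; lra).
    now apply L.
  - unfold n. rewrite pow_inv_Rpower.
    replace (- (1 + d - 2 * eps))
      with ((Re (RtoC (- (1 / 2)) - Ci * t0)%C + 2 * eps) + - INR (2 * K + 2)).
    + rewrite (Rpower_plus _ (- INR (2 * K + 2))). ring.
    + rewrite plus_INR, mult_INR. unfold d.
      replace (Re (RtoC (- (1 / 2)) - Ci * t0)%C) with (- (1 / 2) + Im t0)
        by (destruct t0; unfold Re, Im, Cminus, Cplus, Copp, Cmult, Ci, RtoC; simpl; ring).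
      simpl INR. field.
Qed.

Lemma holo_zeta_coef (K : nat) (t : C) : holo (zeta_coef K) t.
Proof.
  assert (H := two_pi_neq_0). unfold zeta_coef. apply holo_mult.
  - apply holo_div; [apply holo_id|apply holo_const|easy].
  - apply holo_pow. apply holo_div; [|apply holo_const|easy].
    apply holo_ext with (fun t => - (1) * t)%C; [intros; ring|holo_auto].
Qed.

Lemma holo_zeta_arg (K : nat) (t : C) : holo (zeta_arg K) t.
Proof. unfold zeta_arg. holo_auto. Qed.

Lemma holo_Cnpow_half (n : nat) (t : C) :
  holo (fun w => Cnpow n (RtoC (- (1 / 2)) - Ci * w)) t.
Proof.
  apply (holo_comp (Cnpow n) (fun w => RtoC (- (1 / 2)) - Ci * w)%C); [holo_auto|apply holo_Cnpow].
Qed.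

Lemma holo_G_rem_term (K k : nat) (t : C) : (pole_sq k + t)%C <> 0 -> holo (fun w => G_rem_term K w k) t.
Proof.
  intros Ha. induction K as [|K IH].
  - simpl. unfold G_term. fold (pole_sq k). apply holo_mult; [apply holo_Cnpow_half|].
    apply holo_div; [apply holo_id|holo_auto|easy].
  - change (holo (fun w => G_rem_term K w k - zeta_coef K w * Cnpow (S k) (- zeta_arg K w))%C t).
    apply holo_minus; [exact IH|]. apply holo_mult; [apply holo_zeta_coef|].
    apply (holo_comp (Cnpow (S k)) (fun w => - zeta_arg K w)%C); [|apply holo_Cnpow].
    apply holo_ext with (fun w => 0 - zeta_arg K w)%C; [intros; ring|].
    apply holo_minus; [apply holo_const|apply holo_zeta_arg].
Qed.

(* [m = 0] omits nothing, as the summation index [S k] is positive. *)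
Definition G_rem_skip (K m : nat) (t : C) (k : nat) : C :=
  if Nat.eqb (S k) m then 0 else G_rem_term K t k.

Definition G_rem (K m : nat) (t : C) : C := CSeries (G_rem_skip K m t).

Lemma G_rem_skip_bound (K m : nat) (t0 : C) : Im t0 < 3 / 2 + 2 * INR K ->
  exists eps M N, 0 < eps /\ ex_series M /\
    forall k, (N <= k)%nat -> lip_at (fun t => G_rem_skip K m t k) t0 eps (M k).
Proof.
  intros Ht. destruct (G_rem_term_bound K t0 Ht) as [eps [M [N [He [HM HL]]]]].
  exists eps, M, (N + m)%nat. split; [easy|]. split; [easy|]. intros k Hk.
  unfold G_rem_skip. replace (Nat.eqb (S k) m) with false by (symmetry; apply Nat.eqb_neq; lia).
  apply HL. lia.
Qed.

Lemma summable_G_rem_skip (K m : nat) (t : C) : Im t < 3 / 2 + 2 * INR K -> summable (G_rem_skip K m t).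
Proof.
  intros Ht. destruct (G_rem_skip_bound K m t Ht) as [eps [M [N [He [HM HL]]]]].
  apply (ex_series_incr_n (fun k => Cmod (G_rem_skip K m t k)) N).
  apply (summable_le (fun k => G_rem_skip K m t (N + k)%nat) (fun k => M (N + k)%nat)).
  - intros k. apply (HL (N + k)%nat); [lia|]. rewrite Cmod_self. lra.
  - now apply ex_series_incr_n.
Qed.

Lemma holo_G_rem (K m : nat) (t : C) : Im t < 3 / 2 + 2 * INR K ->
  (forall k, S k <> m -> (pole_sq k + t)%C <> 0) -> holo (G_rem K m) t.
Proof.
  intros Ht Ha. destruct (G_rem_skip_bound K m t Ht) as [eps [M [N [He [HM HL]]]]].
  apply (holo_CSeries (fun k t => G_rem_skip K m t k) M t eps N); auto.
  intros k. unfold G_rem_skip. destruct (Nat.eqb_spec (S k) m) as [E|E]; [apply holo_const|].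
  apply holo_G_rem_term. now apply Ha.
Qed.

Lemma Re_zeta_arg (K : nat) (t : C) : Re (zeta_arg K t) = 5 / 2 - Im t + 2 * INR K.
Proof.
  unfold zeta_arg. rewrite mult_INR, (S_INR K). change (INR 2) with 2.
  destruct t; unfold Re, Im, Cplus, Cmult, Ci, RtoC; simpl; field.
Qed.

Lemma G_rem_step (K : nat) (t : C) : Im t < 3 / 2 + 2 * INR K ->
  G_rem (S K) 0 t = (G_rem K 0 t - zeta_coef K t * zeta (zeta_arg K t))%C.
Proof.
  intros Ht. unfold G_rem, zeta.
  assert (Hs : 1 < Re (zeta_arg K t)) by (rewrite Re_zeta_arg; lra).
  (* What remains holds by conversion: [Nat.eqb (S k) 0] reduces and [G_rem_term] recurses on K. *)
  rewrite <- CSeries_scal, <- CSeries_minus; auto using summable_G_rem_skip, summable_scal, summable_zeta.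
Qed.

(** Isolates the only term singular at t = -2 pi (k0+1)^2. *)
Lemma G_rem_split (K k0 : nat) (t : C) : Im t < 3 / 2 + 2 * INR K ->
  G_rem K 0 t = (G_rem_term K t k0 + G_rem K (S k0) t)%C.
Proof.
  intros Ht. unfold G_rem.
  destruct (CSeries_incr_n _ (S k0) (summable_G_rem_skip K 0 t Ht)) as [-> _].
  destruct (CSeries_incr_n _ (S k0) (summable_G_rem_skip K (S k0) t Ht)) as [-> _].
  cbn [Csum].
  rewrite (Csum_ext (G_rem_skip K 0 t) (G_rem_skip K (S k0) t) k0).
  - rewrite (CSeries_ext (fun k => G_rem_skip K 0 t (S k0 + k)%nat) (fun k => G_rem_skip K (S k0) t (S k0 + k)%nat)).
    + unfold G_rem_skip at 2 5. rewrite Nat.eqb_refl. simpl Nat.eqb. cbv iota. ring.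
    + intros k. unfold G_rem_skip.
      replace (Nat.eqb (S (S k0 + k)) (S k0)) with false by (symmetry; apply Nat.eqb_neq; lia). reflexivity.
  - intros k Hk. unfold G_rem_skip.
    replace (Nat.eqb (S k) (S k0)) with false by (symmetry; apply Nat.eqb_neq; lia). reflexivity.
Qed.

(** * Gluing the continuations of G *)

Fixpoint G_zeta_part (K : nat) (t : C) : C :=
  match K with
  | O => 0
  | S J => (G_zeta_part J t + zeta_coef J t * (/ (zeta_arg J t - 1) + zeta_reg (zeta_arg J t)))%C
  end.

Definition G_ext_upto (K : nat) (t : C) : C := (G_zeta_part K t + G_rem K 0 t)%C.

Lemma G_ext_upto_step (K : nat) (t : C) : Im t < 3 / 2 + 2 * INR K -> G_ext_upto (S K) t = G_ext_upto K t.
Proof.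
  intros Ht. unfold G_ext_upto. rewrite G_rem_step by easy. rewrite zeta_eq_zeta_reg.
  - simpl G_zeta_part. ring.
  - rewrite Re_zeta_arg. lra.
Qed.

Lemma G_ext_upto_le (K L : nat) (t : C) : (K <= L)%nat -> Im t < 3 / 2 + 2 * INR K -> G_ext_upto L t = G_ext_upto K t.
Proof.
  intros H Ht. induction H as [|L H IH]; [easy|]. rewrite G_ext_upto_step; [easy|].
  apply le_INR in H. lra.
Qed.

(** The index L satisfies Im t < L, well inside the range Im t < 3/2 + 2L. At the poles the value is
    whatever totalised division yields. *)
Definition G_ext (t : C) : C := G_ext_upto (proj1_sig (half_plane_index (- Im t))) t.

Lemma G_ext_upto_eq (K : nat) (t : C) : Im t < 3 / 2 + 2 * INR K -> G_ext t = G_ext_upto K t.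
Proof.
  intros Ht. unfold G_ext. destruct (half_plane_index (- Im t)) as [L HL]; simpl.
  assert (h := pos_INR L).
  destruct (Nat.le_ge_cases K L); [|symmetry]; apply G_ext_upto_le; try easy; lra.
Qed.

Lemma zeta_arg_eq (K : nat) (t : C) :
  (zeta_arg K t - 1 = Ci * (t - (0, 2 * INR (S K) - 1 / 2)%R))%C.
Proof.
  destruct t as [x y]. unfold zeta_arg. rewrite mult_INR. change (INR 2) with 2.
  unfold Cminus, Cplus, Copp, Cmult, Ci, RtoC; simpl fst; simpl snd. f_equal; field.
Qed.

Lemma holo_G_zeta_part (K : nat) (t : C) :
  (forall j, (1 <= j <= K)%nat -> t <> (0, 2 * INR j - 1 / 2)) -> holo (G_zeta_part K) t.
Proof.
  induction K as [|K IH]; intros H; [apply holo_const|].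
  change (holo (fun w => G_zeta_part K w + zeta_coef K w * (/ (zeta_arg K w - 1) + zeta_reg (zeta_arg K w)))%C t).
  apply holo_plus; [apply IH; intros; apply H; lia|].
  apply holo_mult; [apply holo_zeta_coef|]. apply holo_plus.
  - apply holo_inv; [apply holo_minus; [apply holo_zeta_arg|apply holo_const]|].
    rewrite zeta_arg_eq. apply Cmult_neq_0.
    + intros E. apply (f_equal Im) in E. simpl in E. lra.
    + apply Cminus_neq_0, H. lia.
  - apply (holo_comp zeta_reg (zeta_arg K)); [apply holo_zeta_arg|apply holo_zeta_reg].
Qed.

(* Explicit entire quotients take the place of the removable singularity theorem. *)
Definition factors (f : C -> C) (p : C) : Prop :=
  exists Q : C -> C, (forall z, holo Q z) /\ forall z, f z = (f p + (z - p) * Q z)%C.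

Lemma factors_mult (f g : C -> C) (p : C) :
  factors f p -> factors g p -> factors (fun z => f z * g z)%C p.
Proof.
  intros [P [HP EP]] [Q [HQ EQ]].
  exists (fun z => P z * g p + (f p + (z - p) * P z) * Q z)%C. split.
  - intros z. specialize (HP z). specialize (HQ z). holo_auto.
  - intros z. rewrite (EP z), (EQ z). ring.
Qed.

Lemma factors_linear (c p : C) : factors (fun z => z * c)%C p.
Proof. exists (fun _ => c). split; [intros; apply holo_const|]. intros. ring. Qed.

Lemma factors_ext (f g : C -> C) (p : C) : (forall z, f z = g z) -> factors g p -> factors f p.
Proof. intros E [Q [H K]]. exists Q. split; [easy|]. intros z. now rewrite !E. Qed.

Lemma factors_zeta_coef (K : nat) (p : C) : factors (zeta_coef K) p.
Proof.
  assert (H2 := two_pi_neq_0). unfold zeta_coef.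
  apply (factors_mult (fun t => t / (2 * PI)%R)%C (fun t => (- t / (2 * PI)%R) ^ K)%C).
  - apply (factors_linear (/ (2 * PI)%R)).
  - induction K as [|K IH].
    + exists (fun _ => RtoC 0). split; [intros; apply holo_const|]. intros. simpl. ring.
    + apply (factors_mult (fun t => - t / (2 * PI)%R)%C (fun t => (- t / (2 * PI)%R) ^ K)%C); [|exact IH].
      apply factors_ext with (fun z => z * (- / (2 * PI)%R))%C; [intros; unfold Cdiv; ring|].
      apply factors_linear.
Qed.

(** * Simple poles and their principal parts *)

Lemma Im_near (z p : C) (r : R) : Cmod (z - p) < r -> Im p - r < Im z < Im p + r.
Proof.
  intros H. assert (h := Im_le_Cmod (z - p)%C). change (Im (z - p)%C) with (Im z - Im p) in h.
  eapply Rle_lt_trans in H; [|exact h]. apply Rabs_def2 in H. lra.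
Qed.

Lemma Cdiv_neq_0 (a b : C) : a <> 0 -> b <> 0 -> (a / b)%C <> 0.
Proof.
  intros Ha Hb E. apply Ha. replace a with (a / b * b)%C by (field; exact Hb).
  rewrite E. ring.
Qed.

Lemma G_ext_simple_pole_imag (K : nat) : simple_pole G_ext (0, 2 * INR (S K) - 1 / 2).
Proof.
  set (p := (0, 2 * INR (S K) - 1 / 2) : C).
  assert (HI : Im p = 2 * INR (S K) - 1 / 2) by reflexivity.
  assert (HS := INR_S_ge_1 K).
  assert (Hi : Ci <> 0).
  { intros E. apply (f_equal Im) in E. simpl in E. lra. }
  assert (Hp : p <> 0).
  { intros E. apply (f_equal Im) in E. rewrite HI in E. change (Im 0) with 0 in E. lra. }
  destruct (factors_zeta_coef K p) as [Q [HQ EQ]].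
  exists (zeta_coef K p / Ci)%C. split.
  { assert (H2 := two_pi_neq_0). apply Cdiv_neq_0; [|exact Hi]. unfold zeta_coef.
    apply Cmult_neq_0; [now apply Cdiv_neq_0|]. apply Cpow_nz, Cdiv_neq_0; [|exact H2].
    intros E. apply Hp. replace p with (- - p)%C by ring. rewrite E. ring. }
  (* On this disc Im z lies between 2K + 1 and 2K + 2: above the real axis, above the earlier poles
     (at height at most 2K - 1/2), and within the range of [G_rem (S K)]. *)
  exists (1 / 2). split; [lra|].
  (* The singular summand is [zeta_coef K z] over i(z - p); writing the coefficient as its value at
     p plus (z - p) Q z leaves the regular part Q z / i. *)
  exists (fun z => G_zeta_part K z + (Q z / Ci + zeta_coef K z * zeta_reg (zeta_arg K z)) + G_rem (S K) 0 z)%C. split.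
  - intros z Hz. apply Im_near in Hz. rewrite HI in Hz. apply holo_C_holo_at.
    apply holo_plus; [apply holo_plus; [|apply holo_plus]|].
    + apply holo_G_zeta_part. intros j Hj E. rewrite E in Hz. unfold Im in Hz. cbn [snd] in Hz.
      assert (h : INR j <= INR K) by (apply le_INR; lia). rewrite S_INR in Hz. lra.
    + apply holo_div; [apply HQ|apply holo_const|exact Hi].
    + apply holo_mult; [apply holo_zeta_coef|]. apply (holo_comp zeta_reg (zeta_arg K)); [apply holo_zeta_arg|apply holo_zeta_reg].
    + apply holo_G_rem; [lra|]. intros k _ E. apply (f_equal Im) in E.
      change (0 + Im z = 0) in E. lra.
  - intros z Hz Hzp. assert (Hz' := Im_near _ _ _ Hz). rewrite HI in Hz'.
    rewrite (G_ext_upto_eq (S K)) by lra. unfold G_ext_upto.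
    change (G_zeta_part (S K) z) with (G_zeta_part K z + zeta_coef K z * (/ (zeta_arg K z - 1) + zeta_reg (zeta_arg K z)))%C.
    rewrite zeta_arg_eq. fold p. rewrite (EQ z). field. split; [exact Hi|now apply Cminus_neq_0].
Qed.

Lemma G_ext_simple_pole_real (k0 : nat) :
  simple_pole G_ext (- (2 * PI * (INR (S k0)) ^ 2), 0).
Proof.
  set (p := (- (2 * PI * (INR (S k0)) ^ 2), 0) : C).
  assert (Ep : p = (- pole_sq k0)%C) by (unfold p, pole_sq, RtoC, Copp; simpl; f_equal; ring).
  assert (HI : Im p = 0) by reflexivity.
  assert (HS := INR_S_ge_1 k0). assert (P := PI2_1).
  set (N := fun w => Cnpow (S k0) (RtoC (- (1 / 2)) - Ci * w)).
  set (l := RtoC (ln (INR (S k0)))).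
  exists (p * N p)%C. split.
  { apply Cmult_neq_0; [|apply Cexp_neq_0].
    intros E. apply (f_equal Re) in E. change (- (2 * PI * (INR (S k0)) ^ 2) = 0) in E. nra. }
  (* Other real poles are at distance at least 2 pi, and Im z < 1 keeps the original series, K = 0,
     convergent. *)
  exists 1. split; [lra|].
  (* The singular term is N z times z/(z - p) = 1 + p/(z - p). Since N z = N p exp(-i l (z - p)),
     [expq] takes the factor z - p out of N z - N p. *)
  exists (fun z => N z + p * N p * (- Ci * l) * expq (- Ci * l * (z - p)) + G_rem 0 (S k0) z)%C. split.
  - intros z Hz. assert (Hz' := Im_near _ _ _ Hz). rewrite HI in Hz'. apply holo_C_holo_at.
    apply holo_plus; [apply holo_plus|].
    + apply holo_Cnpow_half.
    + apply holo_mult; [apply holo_const|].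
      apply (holo_comp expq (fun z => - Ci * l * (z - p))%C); [holo_auto|apply holo_expq].
    + apply holo_G_rem; [simpl; lra|]. intros k Hk E.
      assert (Ez : z = (- pole_sq k)%C).
      { replace z with (pole_sq k + z - pole_sq k)%C by ring. rewrite E. ring. }
      assert (h := re_le_Cmod (z - p)%C). rewrite Ez, Ep in h, Hz.
      replace (Re (- pole_sq k - - pole_sq k0)%C) with (2 * PI * (INR (S k0) ^ 2 - INR (S k) ^ 2)) in h
        by (unfold pole_sq, Re, Cminus, Cplus, Copp, RtoC; simpl; ring).
      eapply Rle_lt_trans in Hz; [|exact h]. apply Rabs_def2 in Hz.
      assert (HSk := INR_S_ge_1 k).
      destruct (Nat.lt_total k k0) as [L|[L|L]]; [|lia|].
      * assert (h1 : INR (S k) + 1 <= INR (S k0)) by (rewrite <- S_INR; apply le_INR; lia).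
        assert (1 <= INR (S k0) ^ 2 - INR (S k) ^ 2) by nra. nra.
      * assert (h1 : INR (S k0) + 1 <= INR (S k)) by (rewrite <- S_INR; apply le_INR; lia).
        assert (1 <= INR (S k) ^ 2 - INR (S k0) ^ 2) by nra. nra.
  - intros z Hz Hzp. assert (Hz' := Im_near _ _ _ Hz). rewrite HI in Hz'.
    rewrite (G_ext_upto_eq 0) by (simpl; lra). unfold G_ext_upto. rewrite (G_rem_split 0 k0) by (simpl; lra).
    simpl G_zeta_part. simpl G_rem_term. unfold G_term. fold (pole_sq k0). fold (N z).
    replace (pole_sq k0) with (- p)%C by (rewrite Ep; ring).
    assert (EN : N z = (N p * Cexp (- Ci * l * (z - p)))%C).
    { unfold N, Cnpow. fold l. rewrite <- Cexp_plus. f_equal. ring. }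
    assert (Hd := Cminus_neq_0 _ _ Hzp).
    replace (- p + z)%C with (z - p)%C by ring.
    rewrite EN, expq_spec. field. exact Hd.
Qed.

(* G extends meromorphically to C: there is F : C -> C which equals the
   series on {Im t < 3/2} (off the poles), is holomorphic off the pole set,
   and has a simple pole at each point of the pole set. *)
Theorem mainTheorem10 :
  exists F : C -> C,
    (forall t : C, Im t < 3/2 -> ~ G_pole t ->
       @is_series C_AbsRing C_NormedModule (fun k => G_term t (S k)) (F t)) /\
    (forall z : C, ~ G_pole z -> C_holo_at F z) /\
    (forall p : C, G_pole p -> simple_pole F p).
Proof.
  exists G_ext. split; [|split].
  - intros t Ht _. rewrite (G_ext_upto_eq 0) by (simpl; lra).
    replace (G_ext_upto 0 t) with (G_rem 0 0 t) by (unfold G_ext_upto; simpl; ring).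
    apply (CSeries_correct (G_rem_skip 0 0 t)). apply summable_G_rem_skip. simpl. lra.
  - intros z Hz. apply holo_C_holo_at.
    (* From Im z < K, the unit disc around z satisfies Im w < K + 1 < 3/2 + 2K. *)
    destruct (half_plane_index (- Im z)) as [K HK]. assert (h := pos_INR K).
    apply holo_local with (G_ext_upto K) 1; [lra| |].
    + intros w Hw. apply Im_near in Hw. apply G_ext_upto_eq. lra.
    + apply holo_plus.
      * apply holo_G_zeta_part. intros j Hj E. apply Hz. left. exists j. split; [lia|easy].
      * apply holo_G_rem; [lra|]. intros k _ E. apply Hz. right. exists (S k). split; [lia|].
        replace z with (pole_sq k + z - pole_sq k)%C by ring. rewrite E.
        unfold pole_sq, Cminus, Cplus, Copp, RtoC; simpl; f_equal; ring.
  - intros p [[k [Hk ->]]|[n [Hn ->]]].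
    + destruct k as [|K]; [lia|]. apply G_ext_simple_pole_imag.
    + destruct n as [|k0]; [lia|]. apply G_ext_simple_pole_real.
Qed.
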